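(* Among all rectangle visibility graphs with $n\ge 7$ vertices, the empty graph $E_n$ does not have the largest width, area, or perimeter; that is, for every integer $n\ge 7$ and each parameter $p\in\{\operatorname{width},\operatorname{area},\operatorname{perim}\}$ there is a rectangle visibility graph $G$ with $n$ vertices such that $p(G)>p(E_n)$. Among all rectangle visibility graphs with $n\ge 8$ vertices, the empty graph $E_n$ does not have the largest height; that is, for every integer $n\ge 8$ there is a rectangle visibility graph $G$ with $n$ vertices such that $\operatorname{height}(G)>\operatorname{height}(E_n)$.
   Context: $E_n$ is the graph with $n$ vertices and no edges. An integer rectangle is a set $[x_1,x_2]\times[y_1,y_2]$ with $x_1<x_2$, $y_1<y_2$ integers. Let $S$ be a finite set of integer rectangles with pairwise disjoint interiors (rectangles may share boundary edges). Two rectangles $A,B\in S$ see each other if there is a vertical or horizontal line segment that intersects the interiors of both $A$ and $B$ and intersects no other (closed) rectangle of $S$. $S$ is an RV-representation of a graph $G$ if the vertices of $G$ correspond bijectively to the rectangles of $S$ so that two vertices are adjacent if and only if their rectangles see each other. A graph having an RV-representation is a rectangle visibility graph (RVG). The bounding box of $S$ is the smallest axis-parallel rectangle $R$ containing all rectangles of $S$; it is always turned (rotated by $90^\circ$ if necessary) so that its height is at most its width. Thus the height of $R$ is its shorter side length and the width of $R$ is its longer side length. For an RVG $G$, $\operatorname{height}(G)$, $\operatorname{width}(G)$, $\operatorname{area}(G)$, $\operatorname{perim}(G)$ (the perimeter of $G$) are the minimum height, width, area, perimeter, respectively, of the bounding box, each minimum being taken separately over all RV-representations of $G$. *)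

(* Defs.v *)
From HB Require Import structures.
From mathcomp Require Import all_boot all_order all_algebra.
From mathcomp Require Import all_classical all_reals topology normedtype.

Set Implicit Arguments.
Unset Strict Implicit.
Unset Printing Implicit Defensive.

Import Order.TTheory GRing.Theory Num.Theory.
Import numFieldNormedType.Exports.

Local Open Scope classical_set_scope.
Local Open Scope ring_scope.

Record sgraph (T : finType) := SGraph {
  adj : rel T;
  adj_sym : symmetric adj;
  adj_irr : irreflexive adj
}.

Definition empty_graph (n : nat) : sgraph 'I_n :=
  @SGraph 'I_n (fun _ _ => false) (fun _ _ => erefl) (fun _ => erefl).

Record int_rectangle := IntRectangle {
  xlo : int; xhi : int; ylo : int; yhi : int;
  xlo_lt_xhi : xlo < xhi;
  ylo_lt_yhi : ylo < yhi
}.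

Definition box (R : realType) (x1 x2 y1 y2 : R) : set (R * R) :=
  `[x1, x2] `*` `[y1, y2].

Definition rect_set (R : realType) (A : int_rectangle) : set (R * R) :=
  box (xlo A)%:~R (xhi A)%:~R (ylo A)%:~R (yhi A)%:~R.
Arguments rect_set : clear implicits.

Definition vsegment (R : realType) (l : set (R * R)) : Prop :=
  exists x y1 y2 : R, y1 < y2 /\ l = [set x] `*` `[y1, y2].

Definition hsegment (R : realType) (l : set (R * R)) : Prop :=
  exists y x1 x2 : R, x1 < x2 /\ l = `[x1, x2] `*` [set y].

Definition sees (R : realType) (S : set int_rectangle) (A B : int_rectangle) : Prop :=
  exists l : set (R * R),
    [/\ vsegment l \/ hsegment l,
        l `&` (rect_set R A)° !=set0,
        l `&` (rect_set R B)° !=set0 &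
        forall C, S C -> C <> A -> C <> B -> l `&` rect_set R C = set0].

Definition rv_rep (R : realType) (T : finType) (G : sgraph T)
    (S : set int_rectangle) : Prop :=
  [/\ finite_set S,
      trivIset S (fun A => (rect_set R A)°) &
      exists f : T -> int_rectangle, set_bij [set: T] S f /\
        forall u v : T, u != v -> (adj G u v <-> sees R S (f u) (f v))].

Definition is_rvg (R : realType) (T : finType) (G : sgraph T) : Prop :=
  exists S, rv_rep R G S.

(* The smallest axis-parallel rectangle is taken among rectangles with real
   coordinates; its corners are integral because those of S are. *)
Definition bounding_box (R : realType) (S : set int_rectangle) (b : int_rectangle) :
    Prop :=
  (forall A, S A -> rect_set R A `<=` rect_set R b) /\
  (forall x1 x2 y1 y2 : R,
     (forall A, S A -> rect_set R A `<=` box x1 x2 y1 y2) ->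
     rect_set R b `<=` box x1 x2 y1 y2).

Definition side_x (b : int_rectangle) : nat := `|xhi b - xlo b|%N.
Definition side_y (b : int_rectangle) : nat := `|yhi b - ylo b|%N.

Definition rect_height (b : int_rectangle) : nat := minn (side_x b) (side_y b).
Definition rect_width (b : int_rectangle) : nat := maxn (side_x b) (side_y b).
Definition rect_area (b : int_rectangle) : nat := (side_x b * side_y b)%N.
Definition rect_perim (b : int_rectangle) : nat := (2 * (side_x b + side_y b))%N.

(* 0 is a junk value for the empty set; it never arises for a rectangle
   visibility graph with at least one vertex. *)
Definition minimum (A : set nat) : nat :=
  xget 0%N [set m | A m /\ lbound A m].

Definition graph_min (R : realType) (m : int_rectangle -> nat)
    (T : finType) (G : sgraph T) : nat :=
  minimum [set k | exists S b,
    [/\ rv_rep R G S, bounding_box R S b & k = m b]].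

Definition height (R : realType) (T : finType) (G : sgraph T) : nat :=
  graph_min R rect_height G.
Definition width (R : realType) (T : finType) (G : sgraph T) : nat :=
  graph_min R rect_width G.
Definition area (R : realType) (T : finType) (G : sgraph T) : nat :=
  graph_min R rect_area G.
Definition perim (R : realType) (T : finType) (G : sgraph T) : nat :=
  graph_min R rect_perim G.

(* Main.v *)
Require Import Defs.
From HB Require Import structures.
From mathcomp Require Import all_boot all_order all_algebra.
From mathcomp Require Import all_classical all_reals topology normedtype.
From mathcomp Require Import zify lra.

(** Unit squares along a diagonal represent the empty graph in an n by n box, so
    its height, width, area and perimeter are at most n, n, n^2 and 4n.  It is
    beaten by the complete graph on 7 vertices (width, area, perimeter) or on 8
    vertices (height) together with isolated vertices.  An isolated rectangle
    shares no unit row and no unit column of the grid with another rectangle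
    ([isolated_y_overlap]), so it adds at least 1 to both sides of the box.  What
    remains is to show that the rectangles of a complete graph on 8 vertices meet
    at least 9 rows and 9 columns, and that those of a complete graph on 7
    vertices meet at least 7 rows and 8 columns, or 8 rows and 7 columns.

    Visibility is discrete: two rectangles see each other exactly when some unit
    column or row of the grid meets both and no rectangle between them
    ([sees_visible]).  In a representation of a complete graph any two rectangles
    therefore share a row or share a column, and never both since they are
    disjoint.  The sharing graphs of rows and of columns are thus complementary
    interval graphs, which makes them split graphs: there is a column x such that
    the rectangles that do not cross x pairwise share rows
    ([split_at_column]).  The rectangles crossing x form the stack; the others
    are the sides.  Five rectangles cannot pairwise see each other along rows
    ([no_five_y_clique]), because such visibility graphs are planar, and likewise
    along columns.  So 8 = 4 + 4, and 7 = 4 + 3 up to exchanging the axes.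

    Rows are then counted as follows.  A stack rectangle that shares a row with a
    side rectangle i ends before i, so it also shares rows with every side
    rectangle beyond i, and it needs a new row to see each of them.  Two
    rectangles on opposite sides of x see each other only in rows that avoid the
    whole stack.  Different members of the stack have different rows.  Finally,
    when the stack has four members, each side rectangle shares a row with at
    least one of them, as otherwise five rectangles would pairwise share columns.
    This gives the three counts [rows_stack4_sides4], [rows_stack4_sides3] and
    [rows_stack3_sides4]; the last two also say what happens when only seven rows
    are met, and for 7 vertices these descriptions, read along both axes,
    exclude a 7 by 7 box. *)

Set Implicit Arguments.
Unset Strict Implicit.
Unset Printing Implicit Defensive.

Import Order.TTheory GRing.Theory Num.Theory.
Import numFieldNormedType.Exports.

Local Open Scope ring_scope.

(** * Rectangles on the integer grid *)

(** The integer c stands for the unit column between the abscissas c and c + 1. *)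
Definition in_col (A : int_rectangle) (c : int) := xlo A <= c < xhi A.
Definition in_row (A : int_rectangle) (r : int) := ylo A <= r < yhi A.

(** The interiors of the projections intersect, which for integer intervals means
    that some unit column meets both rectangles. *)
Definition x_overlap (A B : int_rectangle) :=
  (xlo A < xhi B) && (xlo B < xhi A).
Definition y_overlap (A B : int_rectangle) :=
  (ylo A < yhi B) && (ylo B < yhi A).

Definition x_between (A C B : int_rectangle) :=
  (xhi A <= xlo C) && (xhi C <= xlo B) ||
  (xhi B <= xlo C) && (xhi C <= xlo A).
Definition y_between (A C B : int_rectangle) :=
  (yhi A <= ylo C) && (yhi C <= ylo B) ||
  (yhi B <= ylo C) && (yhi C <= ylo A).

(** A rectangle is never between itself and another one, so w may be u or v. *)
Definition row_visible (T : Type) (f : T -> int_rectangle) (u v : T) :=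
  exists r, [/\ in_row (f u) r, in_row (f v) r &
    forall w, in_row (f w) r -> ~~ x_between (f u) (f w) (f v)].
Definition col_visible (T : Type) (f : T -> int_rectangle) (u v : T) :=
  exists c, [/\ in_col (f u) c, in_col (f v) c &
    forall w, in_col (f w) c -> ~~ y_between (f u) (f w) (f v)].

Definition disjoint_family (T : eqType) (f : T -> int_rectangle) :=
  forall u v, u != v -> ~~ (x_overlap (f u) (f v) && y_overlap (f u) (f v)).

(** What remains, on the grid, of a representation of the complete graph on T. *)
Definition clique_rep (T : eqType) (f : T -> int_rectangle) :=
  disjoint_family f /\
  forall u v, u != v -> row_visible f u v \/ col_visible f u v.

Definition meets_rows (T : finType) (f : T -> int_rectangle) (n : nat) :=
  exists s : seq int, [/\ size s = n, uniq s &
    all (fun r => [exists t, in_row (f t) r]) s].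

Definition transpose (A : int_rectangle) : int_rectangle :=
  IntRectangle (ylo_lt_yhi A) (xlo_lt_xhi A).

Definition meets_cols (T : finType) (f : T -> int_rectangle) (n : nat) :=
  meets_rows (transpose \o f) n.

Lemma transpose_clique (T : eqType) (f : T -> int_rectangle) :
  clique_rep f -> clique_rep (transpose \o f).
Proof.
move=> [dis vis]; split=> u v uv.
  by move: (dis u v uv); rewrite andbC.
by case: (vis u v uv); [right | left].
Qed.

Lemma y_overlapC A B : y_overlap A B = y_overlap B A.
Proof. by rewrite /y_overlap andbC. Qed.

Lemma x_overlapC A B : x_overlap A B = x_overlap B A.
Proof. by rewrite /x_overlap andbC. Qed.

Lemma row_overlap A B r : in_row A r -> in_row B r -> y_overlap A B.
Proof. rewrite /in_row /y_overlap; lia. Qed.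

Lemma col_overlap A B c : in_col A c -> in_col B c -> x_overlap A B.
Proof. rewrite /in_col /x_overlap; lia. Qed.

Lemma row_visible_overlap (T : Type) (f : T -> int_rectangle) u v :
  row_visible f u v -> y_overlap (f u) (f v).
Proof. by case=> r [ur vr _]; exact: row_overlap ur vr. Qed.

Lemma col_visible_overlap (T : Type) (f : T -> int_rectangle) u v :
  col_visible f u v -> x_overlap (f u) (f v).
Proof. by case=> r [ur vr _]; exact: col_overlap ur vr. Qed.

Ltac split_ands := repeat match goal with
  | H : is_true (_ && _) |- _ => let H1 := fresh H in let H2 := fresh H in
      case/andP: H => H1 H2
  | H : is_true true |- _ => clear H
  end.

Section Dichotomy.
Variables (T : finType) (f : T -> int_rectangle).
Hypothesis cf : clique_rep f.

(** Disjointness forbids sharing both a row and a column; visibility forbids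
    sharing neither. *)
Lemma x_overlapE u v :
  u != v -> x_overlap (f u) (f v) = ~~ y_overlap (f u) (f v).
Proof.
move=> uv; have := cf.1 u v uv.
case: (cf.2 u v uv) => vis.
  by rewrite (row_visible_overlap vis) andbT => /negbTE.
by rewrite (col_visible_overlap vis) andTb => ->.
Qed.

Lemma y_overlap_visible u v :
  u != v -> y_overlap (f u) (f v) -> row_visible f u v.
Proof.
move=> uv; have := x_overlapE uv => E yuv; rewrite yuv in E.
by case: (cf.2 u v uv) => // vis; rewrite (col_visible_overlap vis) in E.
Qed.

Lemma y_clique_sorted (s : seq T) :
    uniq s -> {in s &, forall u v, u != v -> y_overlap (f u) (f v)} ->
  exists s', perm_eq s s' /\ pairwise (fun u v => xhi (f u) <= xlo (f v)) s'.
Proof.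
move=> us cs; exists (sort (fun u v => xlo (f u) <= xlo (f v)) s).
split; first by rewrite perm_sym perm_sort.
have su : uniq (sort (fun u v => xlo (f u) <= xlo (f v)) s) by rewrite sort_uniq.
have := sort_sorted (leT := fun u v => xlo (f u) <= xlo (f v)) _ s.
rewrite sorted_pairwise; last by move=> ? ? ?; exact: le_trans.
move=> /(_ (fun u v => le_total _ _)) le_s.
rewrite uniq_pairwise in su.
have := pairwise_relI (fun u v => u != v) (fun u v => xlo (f u) <= xlo (f v))
  (sort (fun u v => xlo (f u) <= xlo (f v)) s).
rewrite su le_s /= => both.
have all_s : all (mem s) (sort (fun u v => xlo (f u) <= xlo (f v)) s).
  by apply/allP => t; rewrite mem_sort.
apply: (sub_in_pairwise (P := mem s)) all_s both => u v us' vs' /= /andP[uv uv'].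
have := x_overlapE uv; rewrite (cs u v us' vs' uv) /x_overlap.
have := xlo_lt_xhi (f u); have := xlo_lt_xhi (f v); lia.
Qed.

(** Helly in dimension one: the row just above the highest lower edge works. *)
Lemma y_helly (P : pred T) u0 : P u0 ->
    (forall u v, P u -> P v -> u != v -> y_overlap (f u) (f v)) ->
  exists y, forall u, P u -> in_row (f u) y.
Proof.
move=> Pu0 HP; case: (@arg_maxP _ _ _ u0 P (fun t => ylo (f t)) Pu0) => m Pm mx.
exists (ylo (f m)) => u Pu; have := mx u Pu => /= le_um.
have [->|um] := eqVneq u m; first by rewrite /in_row lexx ylo_lt_yhi.
have := HP u m Pu Pm um; rewrite /y_overlap /in_row; lia.
Qed.

(** Sort the five rectangles a, b, c, d, e from left to right and let y be a row
    that meets all of them.  If a sees c in a row above (below) y, then b stops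
    before that row, so b reaches less far than a and c in that direction.  The
    rows in which a sees c, b sees d and c sees e must then alternate between
    above and below y, and the rows in which a sees d and b sees e contradict each
    other. *)
Lemma no_five_y_clique (s : seq T) : uniq s -> size s = 5%N ->
    {in s &, forall u v, u != v -> y_overlap (f u) (f v)} -> False.
Proof.
move=> us ss cs; have [s' [ps pw]] := y_clique_sorted us cs.
have [y hy] : exists y, forall u, u \in s -> in_row (f u) y.
  case: s ss us cs ps => // u0 s _ _ cs _.
  by apply: (@y_helly (fun u => u \in u0 :: s) u0) => //; rewrite inE eqxx.
move: us ss; rewrite (perm_uniq ps) (perm_size ps).
have {cs} cs : {in s' &, forall u v, u != v -> row_visible f u v}.
  move=> u v us vs uv; apply: y_overlap_visible => //.
  by apply: cs; rewrite ?(perm_mem ps).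
have {ps}hy u : u \in s' -> in_row (f u) y by rewrite -(perm_mem ps); exact: hy.
case: s' pw cs hy => [//|a [//|b [//|c [//|d [//|e [|//]]]]]] pw cs hy u _.
have [ya yb yc yd ye] : [/\ in_row (f a) y, in_row (f b) y, in_row (f c) y,
    in_row (f d) y & in_row (f e) y].
  by split; apply: hy; rewrite !inE eqxx ?orbT.
have [ma mb mc md me] : [/\ a \in [:: a; b; c; d; e], b \in [:: a; b; c; d; e],
    c \in [:: a; b; c; d; e], d \in [:: a; b; c; d; e] &
    e \in [:: a; b; c; d; e]] by split; rewrite !inE eqxx ?orbT.
have lt t := xlo_lt_xhi (f t).
move: pw {u}; rewrite /= => pw; split_ands.
(* A rectangle avoiding the row r but meeting y lies entirely on one side of r. *)
have vis u v : u \in [:: a; b; c; d; e] -> v \in [:: a; b; c; d; e] ->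
    xhi (f u) <= xlo (f v) -> exists r, [/\ in_row (f u) r, in_row (f v) r &
    forall w, xhi (f u) <= xlo (f w) -> xhi (f w) <= xlo (f v) ->
      in_row (f w) y -> if r < y then r < ylo (f w) else yhi (f w) <= r].
  move=> us vs uv; have neq : u != v.
    by apply: contraTneq uv => ->; rewrite -ltNge lt.
  have [r [ur vr out]] := cs u v us vs neq; exists r; split=> // w uw wv wy.
  case: (boolP (in_row (f w) r)) => [/out|]; first by rewrite /x_between uw wv.
  by move: wy; rewrite /in_row; clear; case: (ltP r y); lia.
have [r1 [A1 C1 /(_ b)B1]] := vis a c ma mc ltac:(assumption).
have [r2 [B2 D2 /(_ c)C2]] := vis b d mb md ltac:(assumption).
have [r3 [C3 E3 /(_ d)D3]] := vis c e mc me ltac:(assumption).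
have [r4 [A4 D4 O4]] := vis a d ma md ltac:(assumption).
have [r5 [B5 E5 O5]] := vis b e mb me ltac:(assumption).
have {}B1 : if r1 < y then r1 < ylo (f b) else yhi (f b) <= r1 by apply: B1.
have {}C2 : if r2 < y then r2 < ylo (f c) else yhi (f c) <= r2 by apply: C2.
have {}D3 : if r3 < y then r3 < ylo (f d) else yhi (f d) <= r3 by apply: D3.
have B4 : if r4 < y then r4 < ylo (f b) else yhi (f b) <= r4 by apply: O4.
have C4 : if r4 < y then r4 < ylo (f c) else yhi (f c) <= r4 by apply: O4.
have C5 : if r5 < y then r5 < ylo (f c) else yhi (f c) <= r5 by apply: O5.
have D5 : if r5 < y then r5 < ylo (f d) else yhi (f d) <= r5 by apply: O5.
move: ya yb yc yd ye A1 C1 B2 D2 C3 E3 A4 D4 B5 E5; rewrite /in_row => *.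
split_ands.
move: B1 C2 D3 B4 C4 C5 D5.
case: (ltP r1 y) => ?; case: (ltP r2 y) => ?; case: (ltP r3 y) => ?;
  case: (ltP r4 y) => ?; case: (ltP r5 y) => ? *; clear vis cs hy lt; lia.
Qed.

End Dichotomy.

(** * Splitting a clique at a column *)

(** Among the pairs that share no row take one, (a, b), whose larger right end m is
    minimal, and let x be the last column before m.  Two rectangles ending before
    x share a row by minimality; one ending before x and one starting after it
    share no column.  A rectangle starting after x shares no column with a or b,
    hence shares rows with both; as a and b are separated vertically, it covers
    the gap between them, and so do all rectangles starting after x. *)
Lemma split_at_column (T : finType) (f : T -> int_rectangle) : clique_rep f ->
  exists x, forall u v, ~~ in_col (f u) x -> ~~ in_col (f v) x -> u != v ->
    y_overlap (f u) (f v).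
Proof.
move=> cf; case: (pickP (fun p : T * T =>
    (p.1 != p.2) && ~~ y_overlap (f p.1) (f p.2))) => [p0 Pp0|no]; last first.
  by exists 0 => u v _ _ uv; have := no (u, v); rewrite /= uv /= => /negbFE.
case: (@arg_minP _ _ _ p0 (fun p : T * T =>
    (p.1 != p.2) && ~~ y_overlap (f p.1) (f p.2))
    (fun p => Order.max (xhi (f p.1)) (xhi (f p.2))) Pp0) => -[a b] /= Pab min.
set m := Order.max _ _ in min.
have out w : m <= xlo (f w) ->
    (ylo (f w) < yhi (f a)) && (ylo (f a) < yhi (f w)) &&
    (ylo (f w) < yhi (f b)) && (ylo (f b) < yhi (f w)).
  move=> mw; have far u : xhi (f u) <= m -> y_overlap (f w) (f u).
    move=> um; have wu : w != u.
      apply: contraTneq (le_trans um mw) => ->.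
      by rewrite -ltNge xlo_lt_xhi.
    have := x_overlapE cf wu; rewrite /x_overlap.
    by case: y_overlap => //=; move: um mw; clear; lia.
  have := far a; have := far b; rewrite /y_overlap /m; lia.
exists (m - 1) => u v; rewrite /in_col => xu xv uv.
case/boolP: (y_overlap (f u) (f v)) => // nuv.
have := min (u, v); rewrite /= uv nuv => /(_ isT).
have := x_overlapE cf uv; rewrite nuv /x_overlap => sep.
have := xlo_lt_xhi (f u); have := xlo_lt_xhi (f v).
move=> lu lv; case: (leP m (xlo (f u))) => [mu|]; last lia.
case: (leP m (xlo (f v))) => [mv|]; last lia.
move: Pab nuv (out u mu) (out v mv); rewrite /y_overlap.
have := ylo_lt_yhi (f a); have := ylo_lt_yhi (f b); clear; lia.
Qed.

Section Stack.
Variables (T : finType) (f : T -> int_rectangle) (x : int).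
Hypothesis cf : clique_rep f.

Definition stacked t := in_col (f t) x.

(** i and j lie on the same side of the column x, and i is closer to it. *)
Definition nearer i j :=
  (x < xlo (f i)) && (xhi (f i) <= xlo (f j)) ||
  (xhi (f i) <= x) && (xhi (f j) <= xlo (f i)).

Definition across i j :=
  (xhi (f i) <= x) && (x < xlo (f j)) || (xhi (f j) <= x) && (x < xlo (f i)).

Lemma stacked_no_y_overlap k k' :
  stacked k -> stacked k' -> k != k' -> y_overlap (f k) (f k') = false.
Proof.
move=> sk sk' kk'; have := x_overlapE cf kk'.
by rewrite (col_overlap sk sk') => /esym/negbTE.
Qed.

Lemma row_exists k : exists r, in_row (f k) r.
Proof. by exists (ylo (f k)); rewrite /in_row lexx ylo_lt_yhi. Qed.

Lemma nearer_neq i j : nearer i j -> i != j.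
Proof.
apply: contraTneq => ->; rewrite /nearer; have := xlo_lt_xhi (f j); lia.
Qed.

Lemma across_neq i j : across i j -> i != j.
Proof.
apply: contraTneq => ->; rewrite /across; have := xlo_lt_xhi (f j); lia.
Qed.

(** k ends before i, hence shares no column with j. *)
Lemma stacked_y_overlap_nearer k i j :
  stacked k -> nearer i j -> y_overlap (f k) (f i) -> y_overlap (f k) (f j).
Proof.
move=> sk ij yki; have lti := xlo_lt_xhi (f i); have ltj := xlo_lt_xhi (f j).
have ki : k != i.
  by apply: contraTneq ij => <-; move: sk; rewrite /stacked /in_col /nearer; lia.
have kj : k != j.
  by apply: contraTneq ij => <-; move: sk; rewrite /stacked /in_col /nearer; lia.
have := x_overlapE cf ki; have := x_overlapE cf kj; rewrite yki.
case: (y_overlap (f k) (f j)) => //.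
move: sk ij; rewrite /stacked /in_col /nearer /x_overlap; lia.
Qed.

(** Side rectangles closer to x than i would block the view from k to i. *)
Lemma stacked_row k i : stacked k -> ~~ stacked i -> y_overlap (f k) (f i) ->
  exists r, [/\ in_row (f k) r, in_row (f i) r &
    forall j, nearer j i -> in_row (f j) r = false].
Proof.
move=> sk si yki; have ki : k != i by apply: contraNneq si => <-.
have [r [kr ir out]] := y_overlap_visible cf ki yki.
exists r; split=> // j ji; apply/negP => jr; move/negP: (out j jr); apply.
have := row_overlap kr jr; have jk : k != j.
  apply: contraTneq ji => <-; move: sk si; rewrite /stacked /in_col /nearer.
  have := xlo_lt_xhi (f i); lia.
have := x_overlapE cf jk => + yjk; rewrite yjk.
have := xlo_lt_xhi (f i); have := xlo_lt_xhi (f j); have := xlo_lt_xhi (f k).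
move: sk ji; rewrite /stacked /in_col /nearer /x_overlap /x_between; lia.
Qed.

(** Members of the stack, and rectangles closer to x than i or j, would lie between
    i and j. *)
Lemma across_row i j : across i j -> y_overlap (f i) (f j) ->
  exists r, [/\ in_row (f i) r, in_row (f j) r,
    forall m, nearer m i -> in_row (f m) r = false,
    forall m, nearer m j -> in_row (f m) r = false &
    forall k, stacked k -> in_row (f k) r = false].
Proof.
move=> ij yij; have [r [ir jr out]] := y_overlap_visible cf (across_neq ij) yij.
have lti := xlo_lt_xhi (f i); have ltj := xlo_lt_xhi (f j).
exists r; split=> // m; have ltm := xlo_lt_xhi (f m) => near;
  apply/negP => mr; move/negP: (out m mr); apply.
- by move: near ij; rewrite /nearer /across /x_between; lia.
- by move: near ij; rewrite /nearer /across /x_between; lia.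
have mi : m != i.
  by apply: contraTneq near => ->; move: ij; rewrite /across /stacked /in_col; lia.
have mj : m != j.
  by apply: contraTneq near => ->; move: ij; rewrite /across /stacked /in_col; lia.
have := x_overlapE cf mi; have := x_overlapE cf mj.
rewrite (row_overlap mr ir) (row_overlap mr jr).
move: near ij; rewrite /across /x_between /stacked /in_col /x_overlap; lia.
Qed.

Lemma nearer_row i j : nearer i j -> y_overlap (f i) (f j) ->
  exists r, [/\ in_row (f i) r, in_row (f j) r &
    forall m, nearer i m -> nearer m j -> in_row (f m) r = false].
Proof.
move=> ij yij; have [r [ir jr out]] := y_overlap_visible cf (nearer_neq ij) yij.
exists r; split=> // m im mj; apply/negP => mr; move/negP: (out m mr); apply.
have := xlo_lt_xhi (f i); have := xlo_lt_xhi (f j); have := xlo_lt_xhi (f m).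
by move: ij im mj; rewrite /nearer /x_between; lia.
Qed.

End Stack.

(** * Counting the rows met by a clique *)

Lemma no_five_x_clique (T : finType) (f : T -> int_rectangle) (s : seq T) :
    clique_rep f -> uniq s -> size s = 5%N ->
    {in s &, forall u v, u != v -> x_overlap (f u) (f v)} -> False.
Proof.
by move=> /transpose_clique cf us ss xs; exact: (no_five_y_clique cf us ss).
Qed.

Lemma extend_uniq (T : finType) (P : pred T) (s : seq T) n :
    uniq s -> all P s -> #|P| = (size s + n)%N ->
  exists s', [/\ size s' = n, uniq (s ++ s') & all P s'].
Proof.
move=> us Ps cP; exists [seq t <- enum P | t \notin s].
have un : uniq (s ++ [seq t <- enum P | t \notin s]).
  rewrite cat_uniq us filter_uniq ?enum_uniq // andbT.
  by apply/hasPn => t; rewrite mem_filter => /andP[].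
split=> //; last by apply/allP => t; rewrite mem_filter mem_enum => /andP[].
apply/eqP; rewrite -(eqn_add2l (size s)) -size_cat -cP cardE; apply/eqP.
apply/perm_size/uniq_perm; rewrite ?enum_uniq // => t.
rewrite mem_cat mem_filter mem_enum; case: (boolP (t \in s)) => //= /(allP Ps).
by move=> Pt; rewrite unfold_in Pt.
Qed.

(** Rows are told apart by the rectangles they meet: one row meets a rectangle that
    the other avoids, or both meet one of two rectangles without common row. *)
Ltac rows_differ :=
  let E := fresh in
  apply/eqP => E; subst;
  match goal with
  | H : is_true (in_row (?f ?a) ?r), N : is_true (~~ in_row (?f ?a) ?r) |- _ =>
      by rewrite H in N
  | H : is_true (in_row (?f ?a) ?r),
    N : forall m, is_true (nearer ?f ?x m ?i) -> in_row (?f m) ?r = false,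
    P : is_true (nearer ?f ?x ?a ?i) |- _ =>
      by rewrite (N a P) in H
  | H : is_true (in_row (?f ?a) ?r),
    N : forall k, is_true (stacked ?f ?x k) -> in_row (?f k) ?r = false,
    P : is_true (stacked ?f ?x ?a) |- _ =>
      by rewrite (N a P) in H
  | H : is_true (in_row (?f ?a) ?r),
    N : forall m, is_true (nearer ?f ?x ?i m) -> is_true (nearer ?f ?x m ?j) ->
      in_row (?f m) ?r = false,
    P : is_true (nearer ?f ?x ?i ?a), Q : is_true (nearer ?f ?x ?a ?j) |- _ =>
      by rewrite (N a P Q) in H
  | cf : clique_rep ?f, H : is_true (in_row (?f ?a) ?r),
    H' : is_true (in_row (?f ?b) ?r),
    Sa : is_true (stacked ?f ?x ?a), Sb : is_true (stacked ?f ?x ?b),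
    N : is_true (?a != ?b) |- _ =>
      by move: (stacked_no_y_overlap cf Sa Sb N); rewrite (row_overlap H H')
  | H : is_true (in_row (?f ?a) ?r),
    H' : is_true (in_row (?f ?b) ?r),
    N : is_true (~~ y_overlap (?f ?a) (?f ?b)) |- _ =>
      by move: N; rewrite (row_overlap H H')
  end.

Ltac count_rows s :=
  exists s; split; [by []
  | rewrite /= !inE !negb_or; repeat (apply/andP; split); by [rows_differ | ]
  | rewrite /=; repeat (apply/andP; split); rewrite //;
    by apply/existsP; eexists; eassumption ].

Section Count.
Variables (T : finType) (f : T -> int_rectangle) (x : int).
Hypothesis cf : clique_rep f.
Hypothesis side_clique : forall u v,
  ~~ stacked f x u -> ~~ stacked f x v -> u != v -> y_overlap (f u) (f v).

Lemma card_stacked_le4 : (#|stacked f x| <= 4)%N.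
Proof.
rewrite leqNgt; apply/negP => K5.
have := @extend_uniq _ (stacked f x) [::] #|stacked f x| isT isT erefl.
case=> s [ss us Ks].
apply: (@no_five_x_clique _ _ (take 5 s) cf).
- by rewrite take_uniq.
- by rewrite size_takel // ss.
- move=> u v /mem_take us' /mem_take vs' _.
  by apply: col_overlap (allP Ks _ us') (allP Ks _ vs').
Qed.

Lemma card_side_le4 : (#|[predC stacked f x]| <= 4)%N.
Proof.
rewrite leqNgt; apply/negP => K5.
have := @extend_uniq _ [predC stacked f x] [::] #|[predC stacked f x]| isT isT erefl.
case=> s [ss us Ks].
apply: (@no_five_y_clique _ _ cf (take 5 s)).
- by rewrite take_uniq.
- by rewrite size_takel // ss.
- move=> u v /mem_take us' /mem_take vs'.
  by apply: side_clique; [exact: (allP Ks _ us')| exact: (allP Ks _ vs')].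
Qed.

(** Otherwise i and the four members of the stack would pairwise share columns. *)
Lemma stack_y_overlap i : #|stacked f x| = 4%N -> ~~ stacked f x i ->
  exists k, stacked f x k /\ y_overlap (f k) (f i).
Proof.
move=> K4 si; case: (pickP (fun k => stacked f x k && y_overlap (f k) (f i))).
  by move=> k /andP[]; exists k.
move=> no; have [s [ss us Ks]] := @extend_uniq _ (stacked f x) [::] 4 isT isT K4.
have is_ : i \notin s by apply: contraNN si => /(allP Ks).
case: (@no_five_x_clique _ _ (i :: s) cf); rewrite /= ?ss ?is_ //.
have si' k : k \in s -> x_overlap (f k) (f i).
  move=> ks; have := no k; rewrite (allP Ks _ ks) /= => nyi.
  by rewrite (x_overlapE cf) ?nyi //; apply: contraNneq is_ => <-.
move=> u v; rewrite !inE => /predU1P[->|us'] /predU1P[->|vs'].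
- by rewrite eqxx.
- by rewrite x_overlapC si'.
- by rewrite si'.
- by move=> _; apply: col_overlap (allP Ks _ us') (allP Ks _ vs').
Qed.

Lemma side_list n : #|[predC stacked f x]| = n -> exists s,
  [/\ size s = n, all (fun t => ~~ stacked f x t) s &
      pairwise (fun u v => xhi (f u) <= xlo (f v)) s].
Proof.
move=> In; have [s [ss us Is]] := @extend_uniq _ [predC stacked f x] [::] n isT isT In.
have [|s' [ps pw]] := @y_clique_sorted _ _ cf s us.
  by move=> u v /(allP Is) /= su /(allP Is) /= sv; exact: side_clique.
by exists s'; rewrite -(perm_size ps) -(perm_all _ ps).
Qed.

(** The two positions, up to renaming, of three side rectangles: one facing the two
    others, or all on one side. *)
Lemma three_sides : #|[predC stacked f x]| = 3%N -> exists a b c,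
  [/\ ~~ stacked f x a, ~~ stacked f x b & ~~ stacked f x c] /\
  ([/\ across f x a b, across f x a c & nearer f x b c] \/
   [/\ nearer f x a b, nearer f x a c & nearer f x b c]).
Proof.
move=> /side_list[[|a [|b [|c [|d s]]]] []] // _.
rewrite /= !andbT => /and3P[sa sb sc] /andP[/andP[ab ac] bc].
have lta := xlo_lt_xhi (f a); have ltb := xlo_lt_xhi (f b).
have ltc := xlo_lt_xhi (f c).
have side t : ~~ stacked f x t -> (xhi (f t) <= x) || (x < xlo (f t)).
  by rewrite /stacked /in_col; lia.
case/orP: (side _ sa) => ax; last first.
  exists a, b, c; split=> //; right; rewrite /nearer; split; lia.
case/orP: (side _ sb) => bx; last first.
  exists a, b, c; split=> //; left; rewrite /nearer /across; split; lia.
case/orP: (side _ sc) => cx; last first.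
  exists c, b, a; split=> //; left; rewrite /nearer /across; split; lia.
exists c, b, a; split=> //; right; rewrite /nearer; split; lia.
Qed.

(** The three positions, up to renaming, of four side rectangles: one facing the
    three others, all on one side, or two facing two.  In the first two positions
    b, c, d lie in this order on one side, and a is related to them in the same
    way. *)
Lemma four_sides : #|[predC stacked f x]| = 4%N -> exists a b c d,
  [/\ ~~ stacked f x a, ~~ stacked f x b, ~~ stacked f x c & ~~ stacked f x d] /\
  ([/\ nearer f x b c, nearer f x c d & nearer f x b d] /\
     ([/\ across f x a b, across f x a c & across f x a d] \/
      [/\ nearer f x a b, nearer f x a c & nearer f x a d]) \/
   [/\ nearer f x a b & nearer f x c d] /\
     [/\ across f x a c, across f x a d, across f x b c & across f x b d]).
Proof.
move=> /side_list[[|a [|b [|c [|d [|e s]]]]] []] // _.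
rewrite /= !andbT => /and4P[sa sb sc sd] /and3P[/and3P[ab ac ad] /andP[bc bd] cd].
have lta := xlo_lt_xhi (f a); have ltb := xlo_lt_xhi (f b).
have ltc := xlo_lt_xhi (f c); have ltd := xlo_lt_xhi (f d).
have side t : ~~ stacked f x t -> (xhi (f t) <= x) || (x < xlo (f t)).
  by rewrite /stacked /in_col; lia.
case/orP: (side _ sa) => ax; last first.
  exists a, b, c, d; split=> //; left; rewrite /nearer.
  by split; [split; lia | right; split; lia].
case/orP: (side _ sb) => bx; last first.
  exists a, b, c, d; split=> //; left; rewrite /nearer /across.
  by split; [split; lia | left; split; lia].
case/orP: (side _ sc) => cx; last first.
  exists b, a, c, d; split=> //; right; rewrite /nearer /across.
  by split; split; lia.
case/orP: (side _ sd) => dx; last first.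
  exists d, c, b, a; split=> //; left; rewrite /nearer /across.
  by split; [split; lia | left; split; lia].
exists d, c, b, a; split=> //; left; rewrite /nearer.
by split; [split; lia | right; split; lia].
Qed.

(** Such a k would make a fifth member of a clique of rectangles sharing rows. *)
Lemma stacked_not_all_sides k a b c d : stacked f x k ->
    all (fun t => ~~ stacked f x t) [:: a; b; c; d] -> uniq [:: a; b; c; d] ->
    all (fun t => y_overlap (f k) (f t)) [:: a; b; c; d] -> False.
Proof.
move=> sk side un ys.
have kn : k \notin [:: a; b; c; d] by apply/negP => /(allP side); rewrite sk.
apply: (@no_five_y_clique _ _ cf (k :: [:: a; b; c; d])) => //.
  by rewrite cons_uniq kn.
move=> u v; rewrite [u \in _]inE [v \in _]inE.
move=> /predU1P[->|us] /predU1P[->|vs]; first by rewrite eqxx.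
- by rewrite (allP ys _ vs).
- by rewrite y_overlapC (allP ys _ us).
- by apply: side_clique; [exact: (allP side _ us)| exact: (allP side _ vs)].
Qed.

Lemma across_side_row i j :
    ~~ stacked f x i -> ~~ stacked f x j -> across f x i j ->
  exists r, [/\ in_row (f i) r, in_row (f j) r,
    forall m, nearer f x m i -> in_row (f m) r = false,
    forall m, nearer f x m j -> in_row (f m) r = false &
    forall k, stacked f x k -> in_row (f k) r = false].
Proof.
move=> si sj ij; apply: across_row => //.
by apply: side_clique => //; exact: across_neq ij.
Qed.

Lemma nearer_side_row i j :
    ~~ stacked f x i -> ~~ stacked f x j -> nearer f x i j ->
  exists r, [/\ in_row (f i) r, in_row (f j) r &
    forall m, nearer f x i m -> nearer f x m j -> in_row (f m) r = false].
Proof.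
move=> si sj ij; apply: nearer_row => //.
by apply: side_clique => //; exact: nearer_neq ij.
Qed.

Lemma stack_of_4 k1 : #|stacked f x| = 4%N -> stacked f x k1 ->
  exists k2 k3 k4,
    [/\ stacked f x k2, stacked f x k3, stacked f x k4 & uniq [:: k1; k2; k3; k4]].
Proof.
move=> K4 s1; have [|s [ss us Ks]] := @extend_uniq _ (stacked f x) [:: k1] 3 isT _ K4.
  by rewrite /= s1.
case: s ss us Ks => [//|k2 [//|k3 [//|k4 [|//]]]] _ us /= /and4P[s2 s3 s4 _].
by exists k2, k3, k4.
Qed.

Lemma stack_of_4_pair k1 k2 :
    #|stacked f x| = 4%N -> stacked f x k1 -> stacked f x k2 -> k1 != k2 ->
  exists k3 k4, [/\ stacked f x k3, stacked f x k4 & uniq [:: k1; k2; k3; k4]].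
Proof.
move=> K4 s1 s2 k12.
have [||s [ss us Ks]] := @extend_uniq _ (stacked f x) [:: k1; k2] 2 _ _ K4.
- by rewrite /= inE k12.
- by rewrite /= s1 s2.
case: s ss us Ks => [//|k3 [//|k4 [|//]]] _ us /= /and3P[s3 s4 _].
by exists k3, k4.
Qed.

Lemma nearer_across_uniq4 a b c d :
    nearer f x b c -> nearer f x c d -> nearer f x b d ->
    [/\ across f x a b, across f x a c & across f x a d] \/
    [/\ nearer f x a b, nearer f x a c & nearer f x a d] ->
  uniq [:: a; b; c; d].
Proof.
move=> /nearer_neq bc /nearer_neq cd /nearer_neq bd.
case=> [] [] => [/across_neq ab /across_neq ac /across_neq ad
  |/nearer_neq ab /nearer_neq ac /nearer_neq ad];
by rewrite /= !inE !negb_or ab ac ad bc bd cd.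
Qed.

(** The rectangle nearest to x on each side shares a row with a member of the stack,
    which then needs a row for each side rectangle on that side.  The sides cannot
    all lie on one side, nor can one k serve both sides, as k would share rows with
    all four.  So the stack meets 4 + 2 rows at least, and views across x use 3
    further rows. *)
Lemma rows_stack4_sides4 :
  #|stacked f x| = 4%N -> #|[predC stacked f x]| = 4%N -> meets_rows f 9.
Proof.
move=> K4 /four_sides [a [b [c [d [[sa sb sc sd]]]]]].
have [ka [ska yka]] := stack_y_overlap K4 sa.
case=> [[[bc cd bd]] abcd|[[ab cd] [ac ad bc bd]]].
  have un := nearer_across_uniq4 bc cd bd abcd.
  case: abcd => [] [ab ac ad]; last first.
    case: (@stacked_not_all_sides ka a b c d) => //=; first by rewrite sa sb sc sd.
    by rewrite yka !(stacked_y_overlap_nearer cf ska _ yka).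
  have [kb [skb ykb]] := stack_y_overlap K4 sb.
  have ykc := stacked_y_overlap_nearer cf skb bc ykb.
  have ykd := stacked_y_overlap_nearer cf skb bd ykb.
  have kab : ka != kb.
    apply/eqP => E; case: (@stacked_not_all_sides kb a b c d) => //=.
      by rewrite sa sb sc sd.
    by rewrite ykb ykc ykd -E yka.
  have [k3 [k4 [sk3 sk4 uk]]] := stack_of_4_pair K4 ska skb kab.
  move: uk; rewrite /= !inE !negb_or => uk; split_ands.
  have [r1 [? ? ?]] := stacked_row cf ska sa yka.
  have [r2 [? ? ?]] := stacked_row cf skb sb ykb.
  have [r3 [? ? ?]] := stacked_row cf skb sc ykc.
  have [r4 [? ? ?]] := stacked_row cf skb sd ykd.
  have [r5 ?] := row_exists f k3.
  have [r6 ?] := row_exists f k4.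
  have [r7 [? ? ? ? ?]] := across_side_row sa sb ab.
  have [r8 [? ? ? ? ?]] := across_side_row sa sc ac.
  have [r9 [? ? ? ? ?]] := across_side_row sa sd ad.
  by count_rows [:: r1; r2; r3; r4; r5; r6; r7; r8; r9].
have [kc [skc ykc]] := stack_y_overlap K4 sc.
have ykb := stacked_y_overlap_nearer cf ska ab yka.
have ykd := stacked_y_overlap_nearer cf skc cd ykc.
have kac : ka != kc.
  apply/eqP => E; case: (@stacked_not_all_sides kc a b c d) => //=.
  - by rewrite sa sb sc sd.
  - by rewrite !inE !negb_or (nearer_neq ab) (nearer_neq cd)
      (across_neq ac) (across_neq ad) (across_neq bc) (across_neq bd).
  - by rewrite ykc ykd -E yka ykb.
have [k3 [k4 [sk3 sk4 uk]]] := stack_of_4_pair K4 ska skc kac.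
move: uk; rewrite /= !inE !negb_or => uk; split_ands.
have [r1 [? ? ?]] := stacked_row cf ska sa yka.
have [r2 [? ? ?]] := stacked_row cf ska sb ykb.
have [r3 [? ? ?]] := stacked_row cf skc sc ykc.
have [r4 [? ? ?]] := stacked_row cf skc sd ykd.
have [r5 ?] := row_exists f k3.
have [r6 ?] := row_exists f k4.
have [r7 [? ? ? ? ?]] := across_side_row sb sc bc.
have [r8 [? ? ? ? ?]] := across_side_row sb sd bd.
have [r9 [? ? ? ? ?]] := across_side_row sa sc ac.
by count_rows [:: r1; r2; r3; r4; r5; r6; r7; r8; r9].
Qed.

Lemma meets_rows_leq m n : (m <= n)%N -> meets_rows f n -> meets_rows f m.
Proof.
move=> mn [s [ss us fs]]; exists (take m s); split.
- by rewrite size_takel ?ss.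
- exact: take_uniq.
- by apply/allP => r /mem_take; exact: (allP fs).
Qed.

(** The rectangle b is the nearest one on the side that holds at least two side
    rectangles, or the second nearest if all are on one side.  A member of the
    stack sharing a row with b also sees c, so two such members cost one more row.
    This is the form in which a tight count along one axis is refuted by the other
    axis. *)
Lemma rows_stack4_sides3 : #|stacked f x| = 4%N -> #|[predC stacked f x]| = 3%N ->
  meets_rows f 7 /\ exists b c,
    [/\ ~~ stacked f x b, ~~ stacked f x c, nearer f x b c &
    forall k k', stacked f x k -> stacked f x k' -> k != k' ->
      y_overlap (f k) (f b) -> y_overlap (f k') (f b) -> meets_rows f 8].
Proof.
move=> K4 /three_sides [a [b [c [[sa sb sc]]]]].
have row k i := @stacked_row _ f x cf k i.
case=> -[ab ac bc].
  have [r1 [? ? ? ? ?]] := across_side_row sa sb ab.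
  have [r2 [? ? ? ? ?]] := across_side_row sa sc ac.
  split; [|exists b, c; split=> // k k' sk sk' kk' yb yb'].
    have [kb [skb yb]] := stack_y_overlap K4 sb.
    have yc := stacked_y_overlap_nearer cf skb bc yb.
    have [k2 [k3 [k4 [sk2 sk3 sk4 uk]]]] := stack_of_4 K4 skb.
    move: uk; rewrite /= !inE !negb_or => uk; split_ands.
    have [r3 [? ? ?]] := row _ _ skb sb yb.
    have [r4 [? ? ?]] := row _ _ skb sc yc.
    have [r5 ?] := row_exists f k2.
    have [r6 ?] := row_exists f k3.
    have [r7 ?] := row_exists f k4.
    by count_rows [:: r1; r2; r3; r4; r5; r6; r7].
  have yc := stacked_y_overlap_nearer cf sk bc yb.
  have yc' := stacked_y_overlap_nearer cf sk' bc yb'.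
  have [k3 [k4 [sk3 sk4 uk]]] := stack_of_4_pair K4 sk sk' kk'.
  move: uk; rewrite /= !inE !negb_or => uk; split_ands.
  have [r3 [? ? ?]] := row _ _ sk sb yb.
  have [r4 [? ? ?]] := row _ _ sk sc yc.
  have [r5 [? ? ?]] := row _ _ sk' sb yb'.
  have [r6 [? ? ?]] := row _ _ sk' sc yc'.
  have [r7 ?] := row_exists f k3.
  have [r8 ?] := row_exists f k4.
  by count_rows [:: r1; r2; r3; r4; r5; r6; r7; r8].
have [ka [ska ya]] := stack_y_overlap K4 sa.
have yb := stacked_y_overlap_nearer cf ska ab ya.
have yc := stacked_y_overlap_nearer cf ska ac ya.
have [r1 [? ? ?]] := row _ _ ska sb yb.
have [r2 [? ? ?]] := row _ _ ska sc yc.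
(* Two members of the stack sharing rows with a need three rows each. *)
have double k' : stacked f x k' -> ka != k' -> y_overlap (f k') (f a) ->
    meets_rows f 8.
  move=> sk' kk' ya'.
  have yb' := stacked_y_overlap_nearer cf sk' ab ya'.
  have yc' := stacked_y_overlap_nearer cf sk' ac ya'.
  have [k3 [k4 [sk3 sk4 uk]]] := stack_of_4_pair K4 ska sk' kk'.
  move: uk; rewrite /= !inE !negb_or => uk; split_ands.
  have [r3 [? ? ?]] := row _ _ ska sa ya.
  have [r4 [? ? ?]] := row _ _ sk' sa ya'.
  have [r5 [? ? ?]] := row _ _ sk' sb yb'.
  have [r6 [? ? ?]] := row _ _ sk' sc yc'.
  have [r7 ?] := row_exists f k3.
  have [r8 ?] := row_exists f k4.
  by count_rows [:: r1; r2; r3; r4; r5; r6; r7; r8].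
(* Otherwise the rows in which a sees b and c avoid the stack except for ka. *)
have [r3 [? ? ?]] := nearer_side_row sa sb ab.
have [r4 [? ? ?]] := nearer_side_row sa sc ac.
case: (pickP (fun k' => [&& stacked f x k', ka != k' & y_overlap (f k') (f a)])).
  move=> k' /and3P[sk' kk' ya']; have rows8 := double k' sk' kk' ya'.
  split; first exact: meets_rows_leq rows8.
  by exists b, c; split.
move=> none; have apart k' : stacked f x k' -> ka != k' -> ~~ y_overlap (f k') (f a).
  by move=> sk' kk'; have := none k'; rewrite sk' kk' /= => ->.
split.
  have [k2 [k3 [k4 [sk2 sk3 sk4 uk]]]] := stack_of_4 K4 ska.
  move: uk; rewrite /= !inE !negb_or => uk; split_ands.
  have [r5 ?] := row_exists f k2.
  have [r6 ?] := row_exists f k3.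
  have [r7 ?] := row_exists f k4.
  have c2 : ~~ y_overlap (f k2) (f a) by apply: apart.
  have c3 : ~~ y_overlap (f k3) (f a) by apply: apart.
  have c4 : ~~ y_overlap (f k4) (f a) by apply: apart.
  by count_rows [:: r1; r2; r3; r4; r5; r6; r7].
have second k' : stacked f x k' -> ka != k' -> y_overlap (f k') (f b) -> meets_rows f 8.
  move=> sk' kk' yb'.
  have yc' := stacked_y_overlap_nearer cf sk' bc yb'.
  have [k3 [k4 [sk3 sk4 uk]]] := stack_of_4_pair K4 ska sk' kk'.
  move: uk; rewrite /= !inE !negb_or => uk; split_ands.
  have [r5 [? ? ?]] := row _ _ sk' sb yb'.
  have [r6 [? ? ?]] := row _ _ sk' sc yc'.
  have [r7 ?] := row_exists f k3.
  have [r8 ?] := row_exists f k4.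
  have c2 : ~~ y_overlap (f k') (f a) by apply: apart.
  have c3 : ~~ y_overlap (f k3) (f a) by apply: apart.
  have c4 : ~~ y_overlap (f k4) (f a) by apply: apart.
  by count_rows [:: r1; r2; r3; r4; r5; r6; r7; r8].
exists b, c; split=> // k k' sk sk' kk' yb_ yb'.
have [E|nE] := eqVneq ka k; last exact: second sk nE yb_.
by apply: second sk' _ yb'; rewrite E.
Qed.

Lemma stack_of_3 k1 : #|stacked f x| = 3%N -> stacked f x k1 ->
  exists k2 k3, [/\ stacked f x k2, stacked f x k3 & uniq [:: k1; k2; k3]].
Proof.
move=> K3 s1; have [|s [ss us Ks]] := @extend_uniq _ (stacked f x) [:: k1] 2 isT _ K3.
  by rewrite /= s1.
case: s ss us Ks => [//|k2 [//|k3 [|//]]] _ us /= /and3P[s2 s3 _].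
by exists k2, k3.
Qed.

(** Four rows are needed for the views between the sides, unless a member of the
    stack intrudes on them; but such an intruder needs several rows itself. *)
Lemma rows_stack3_sides4 : #|stacked f x| = 3%N -> #|[predC stacked f x]| = 4%N ->
  meets_rows f 8 \/ meets_rows f 7 /\ exists i i',
    [/\ ~~ stacked f x i, ~~ stacked f x i', i != i' &
     forall k, stacked f x k ->
       ~~ y_overlap (f k) (f i) && ~~ y_overlap (f k) (f i')].
Proof.
move=> K3 /four_sides [a [b [c [d [[sa sb sc sd]]]]]].
have row k i := @stacked_row _ f x cf k i.
have [k1 [k2 [k3 [sk1 sk2 sk3 uk]]]] :
    exists k1 k2 k3,
      [/\ stacked f x k1, stacked f x k2, stacked f x k3 & uniq [:: k1; k2; k3]].
  have [[|k1 [|k2 [|k3 [|k4 s]]]] []] := @extend_uniq _ (stacked f x) [::] 3 isT isT K3 => //.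
  by move=> _ us /and4P[? ? ? _]; exists k1, k2, k3.
move: uk; rewrite /= !inE !negb_or => uk; split_ands.
have [q1 ?] := row_exists f k1.
have [q2 ?] := row_exists f k2.
have [q3 ?] := row_exists f k3.
case=> [[[bc cd bd]] abcd|[[ab cd] [ac ad bc bd]]].
  have un := nearer_across_uniq4 bc cd bd abcd.
  have nb := nearer_neq bc; have nd := nearer_neq cd.
  (* The views from a use rows that avoid the stack: either they cross x, or a
     shares no row with the stack, because a row shared with a leads to rows shared
     with b, c and d. *)
  have [r1 [r2 [r3 [[? ? ?] [[? ? ? ?] [? ? ? ? ?]]]]]] : exists r1 r2 r3,
      [/\ in_row (f a) r1, in_row (f b) r1 &
        forall k, stacked f x k -> in_row (f k) r1 = false] /\
      [/\ in_row (f a) r2, in_row (f c) r2, ~~ in_row (f b) r2 &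
        forall k, stacked f x k -> in_row (f k) r2 = false] /\
      [/\ in_row (f a) r3, in_row (f d) r3, ~~ in_row (f b) r3, ~~ in_row (f c) r3 &
        forall k, stacked f x k -> in_row (f k) r3 = false].
    case: abcd => [] [ab ac ad].
      have [r1 [? ? _ _ ?]] := across_side_row sa sb ab.
      have [r2 [? ? _ B2 ?]] := across_side_row sa sc ac.
      have [r3 [? ? _ B3 ?]] := across_side_row sa sd ad.
      exists r1, r2, r3; split; first by split.
      by split; split; rewrite ?(B2 _ bc) ?(B3 _ bd) ?(B3 _ cd).
    have [r1 [A1 ? _]] := nearer_side_row sa sb ab.
    have [r2 [A2 ? B2]] := nearer_side_row sa sc ac.
    have [r3 [A3 ? B3]] := nearer_side_row sa sd ad.
    have apart r : in_row (f a) r -> forall k, stacked f x k -> in_row (f k) r = false.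
      move=> ar k sk; apply/negP => kr; have ya := row_overlap kr ar.
      apply: (@stacked_not_all_sides k a b c d) => //=; first by rewrite sa sb sc sd.
      by rewrite ya !(stacked_y_overlap_nearer cf sk _ ya).
    exists r1, r2, r3; split; first by split=> //; exact: apart.
    by split; split; rewrite ?(B2 _ ab bc) ?(B3 _ ab bd) ?(B3 _ ac cd) //; apply: apart.
  case: (pickP (fun k => stacked f x k && y_overlap (f k) (f b))) => [k /andP[sk yb]|nob].
    have [k' [k'' [sk' sk'' uk]]] := stack_of_3 K3 sk.
    move: uk; rewrite /= !inE !negb_or => uk; split_ands.
    have [r4 [? ? ?]] := row _ _ sk sb yb.
    have [r5 [? ? ?]] := row _ _ sk sc (stacked_y_overlap_nearer cf sk bc yb).
    have [r6 [? ? ?]] := row _ _ sk sd (stacked_y_overlap_nearer cf sk bd yb).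
    have [r7 ?] := row_exists f k'.
    have [r8 ?] := row_exists f k''.
    by left; count_rows [:: r1; r2; r3; r4; r5; r6; r7; r8].
  have apart k : stacked f x k -> ~~ y_overlap (f k) (f b).
    by move=> sk; have := nob k; rewrite sk /= => ->.
  have [r4 [? ? ?]] := nearer_side_row sb sc bc.
  have [r5 [? ? ?]] := nearer_side_row sb sd bd.
  case: (pickP (fun k => stacked f x k && y_overlap (f k) (f c))) => [k /andP[sk yc]|noc].
    have [k' [k'' [sk' sk'' uk]]] := stack_of_3 K3 sk.
    move: uk; rewrite /= !inE !negb_or => uk; split_ands.
    have [? ? ?] := And3 (apart k sk) (apart k' sk') (apart k'' sk'').
    have [r6 [? ? ?]] := row _ _ sk sc yc.
    have [r1' [? ? ?]] := row _ _ sk sd (stacked_y_overlap_nearer cf sk cd yc).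
    have [r7 ?] := row_exists f k'.
    have [r8 ?] := row_exists f k''.
    by left; count_rows [:: r1'; r2; r3; r4; r5; r6; r7; r8].
  right; split; last first.
    exists b, c; split=> // k sk.
    by have := noc k; rewrite apart // sk /= => ->.
  have [? ? ?] := And3 (apart k1 sk1) (apart k2 sk2) (apart k3 sk3).
  by count_rows [:: r2; r3; r4; r5; q1; q2; q3].
have [r1 [? ? ? ? ?]] := across_side_row sb sc bc.
have [r2 [? ? ? ? ?]] := across_side_row sb sd bd.
have [r3 [? ? ? ? ?]] := across_side_row sa sc ac.
have [r4 [? ? ? ? ?]] := across_side_row sa sd ad.
case: (pickP (fun k => stacked f x k && y_overlap (f k) (f a))) => [k /andP[sk ya]|noa].
  have [k' [k'' [sk' sk'' uk]]] := stack_of_3 K3 sk.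
  move: uk; rewrite /= !inE !negb_or => uk; split_ands.
  have [r5 [? ? ?]] := row _ _ sk sa ya.
  have [r6 [? ? ?]] := row _ _ sk sb (stacked_y_overlap_nearer cf sk ab ya).
  have [r7 ?] := row_exists f k'.
  have [r8 ?] := row_exists f k''.
  by left; count_rows [:: r1; r2; r3; r4; r5; r6; r7; r8].
case: (pickP (fun k => stacked f x k && y_overlap (f k) (f c))) => [k /andP[sk yc]|noc].
  have [k' [k'' [sk' sk'' uk]]] := stack_of_3 K3 sk.
  move: uk; rewrite /= !inE !negb_or => uk; split_ands.
  have [r5 [? ? ?]] := row _ _ sk sc yc.
  have [r6 [? ? ?]] := row _ _ sk sd (stacked_y_overlap_nearer cf sk cd yc).
  have [r7 ?] := row_exists f k'.
  have [r8 ?] := row_exists f k''.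
  by left; count_rows [:: r1; r2; r3; r4; r5; r6; r7; r8].
right; split; first by count_rows [:: r1; r2; r3; r4; q1; q2; q3].
exists a, c; split=> // [|k sk]; first exact: across_neq ac.
by have := noa k; have := noc k; rewrite sk /= => -> ->.
Qed.

End Count.

(** * Complete graphs on seven and eight vertices *)

Lemma card_stack_sides (T : finType) (f : T -> int_rectangle) x :
  (#|stacked f x| + #|[predC stacked f x]| = #|T|)%N.
Proof. exact: cardC. Qed.

(** Both parts of the split have at most four members, hence exactly four. *)
Lemma eight_clique_rows (T : finType) (f : T -> int_rectangle) :
  clique_rep f -> #|T| = 8%N -> meets_rows f 9.
Proof.
move=> cf T8; have [x side] := split_at_column cf.
have K4 := card_stacked_le4 x cf; have I4 := card_side_le4 cf side.
have := card_stack_sides f x; rewrite T8 => KI.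
by apply: (rows_stack4_sides4 cf side); move: KI K4 I4; lia.
Qed.

Lemma eight_clique_cols (T : finType) (f : T -> int_rectangle) :
  clique_rep f -> #|T| = 8%N -> meets_cols f 9.
Proof. by move/transpose_clique; exact: eight_clique_rows. Qed.

(** The three side rectangles have a common row y.  If a member k of the stack meets
    y, the row y is crossed by four rectangles, and the count for a stack of four
    applies along both axes.  Let b and b' be the special rectangles of the two
    counts.  Whether b and b' share a row or a column, one of the counts
    improves: k and b' both share rows with b, or k and b both share columns with
    b'.  If no member of the stack meets y, the columns are counted with a stack of
    three; should this give only seven, two members of the stack share rows with
    all sides, in particular with b, and eight rows are met. *)
Lemma seven_clique_stack_4 (T : finType) (f : T -> int_rectangle) x :
    clique_rep f ->
    (forall u v, ~~ stacked f x u -> ~~ stacked f x v -> u != v ->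
      y_overlap (f u) (f v)) ->
    #|stacked f x| = 4%N -> #|[predC stacked f x]| = 3%N ->
  meets_rows f 7 /\ meets_cols f 8 \/ meets_rows f 8 /\ meets_cols f 7.
Proof.
move=> cf side K4 I3; have [rows7 [b [_ [sb _ _ two]]]] := rows_stack4_sides3 cf side K4 I3.
have [y Iy] := y_helly (P := [predC stacked f x]) sb side.
have ctf := transpose_clique cf; pose g := transpose \o f.
have sideg u v : ~~ stacked g y u -> ~~ stacked g y v -> u != v ->
    y_overlap (g u) (g v).
  have st w : ~~ stacked g y w -> stacked f x w by apply: contraNT => /Iy.
  by move=> /st su /st sv _; exact: col_overlap su sv.
have cT := card_stack_sides g y; rewrite -(card_stack_sides f x) K4 I3 in cT.
case: (pickP (fun k => stacked f x k && in_row (f k) y)) => [k /andP[sk ky]|none].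
  have Kg : #|stacked g y| = 4%N.
    have nk : k \notin [predC stacked f x] by rewrite inE /= negbK.
    have U := cardU1 k [predC stacked f x]; rewrite nk I3 in U.
    rewrite -[RHS]U; apply: eq_card => t; rewrite !inE.
    apply/idP/predU1P => [ty|[->|/Iy]] //; have [->|tk] := eqVneq t k; first by left.
    right; apply/negP => /= st; have := stacked_no_y_overlap cf st sk tk.
    by rewrite (row_overlap ty ky).
  have Ig : #|[predC stacked g y]| = 3%N by move: cT Kg; lia.
  have [cols7 [b' [_ [sb' _ _ two']]]] := rows_stack4_sides3 ctf sideg Kg Ig.
  have stb' : stacked f x b' by apply: contraNT sb' => /Iy.
  have kb' : k != b' by apply: contraNneq sb' => <-.
  have kb : k != b by apply: contraTneq sk => ->.
  have bb' : b' != b by apply: contraTneq stb' => ->.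
  case/boolP: (y_overlap (f b') (f b)) => ov; [right|left]; split=> //.
    by apply: (two k b') => //; exact: row_overlap ky (Iy b sb).
  apply: (two' k b) => //; [exact: Iy| exact: col_overlap sk stb'|].
  by rewrite -[y_overlap _ _]/(x_overlap (f b) (f b')) x_overlapC (x_overlapE cf bb').
have Kg : #|stacked g y| = 3%N.
  rewrite -I3; apply: eq_card => t; rewrite !inE.
  apply/idP/idP => [ty|/Iy] //; apply/negP => st.
  by move/negP: (none t); apply; apply/andP; split; [exact: st | exact: ty].
have Ig : #|[predC stacked g y]| = 4%N by move: cT Kg; lia.
case: (rows_stack3_sides4 ctf sideg Kg Ig) => [cols8|[cols7 [i [i' [si si' ii' sep]]]]].
  by left.
right; split=> //; have ov j : ~~ stacked g y j ->
    ~~ x_overlap (f b) (f j) -> stacked f x j /\ y_overlap (f j) (f b).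
  move=> sj nov; have stj : stacked f x j by apply: contraNT sj => /Iy.
  have jb : j != b by apply: contraTneq stj => ->.
  by split=> //; move: nov; rewrite x_overlapC (x_overlapE cf jb) negbK.
have /andP[n n'] := sep b (Iy b sb).
have [sti yi] := ov i si n; have [sti' yi'] := ov i' si' n'.
exact: two sti sti' ii' yi yi'.
Qed.

(** If the stack has only three members, then the four sides have a common row,
    and cutting along it exchanges the two parts. *)
Lemma seven_clique_rows_cols (T : finType) (f : T -> int_rectangle) :
    clique_rep f -> #|T| = 7%N ->
  meets_rows f 7 /\ meets_cols f 8 \/ meets_rows f 8 /\ meets_cols f 7.
Proof.
move=> cf T7; have [x side] := split_at_column cf.
have K4 := card_stacked_le4 x cf; have I4 := card_side_le4 cf side.
have := card_stack_sides f x; rewrite T7 => KI.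
have [K|K] : #|stacked f x| = 4%N \/ #|[predC stacked f x]| = 4%N.
  by move: KI K4 I4; lia.
  by apply: (seven_clique_stack_4 cf side K); move: KI K; lia.
have [b sb] : exists b, [predC stacked f x] b.
  by case: (pickP [predC stacked f x]) => [b|/eq_card0]; [exists b|rewrite K].
have [y Iy] := y_helly (P := [predC stacked f x]) sb side.
have ctf := transpose_clique cf; pose g := transpose \o f.
have Kg4 := card_stacked_le4 y ctf.
have : (#|[predC stacked f x]| <= #|stacked g y|)%N.
  by apply: subset_leq_card; apply/fintype.subsetP => t /Iy.
have := card_stack_sides g y; rewrite T7 => cT IK.
have sideg u v : ~~ stacked g y u -> ~~ stacked g y v -> u != v ->
    y_overlap (g u) (g v).
  have st w : ~~ stacked g y w -> stacked f x w by apply: contraNT => /Iy.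
  by move=> /st su /st sv _; exact: col_overlap su sv.
have Kg : #|stacked g y| = 4%N.
  by apply: anti_leq; rewrite -{2}K IK andbT; exact: Kg4.
have Ig : #|[predC stacked g y]| = 3%N by move: cT Kg; lia.
by case: (seven_clique_stack_4 ctf sideg Kg Ig) => -[cols rows]; [right|left].
Qed.

(** * Visibility in the plane and on the grid *)

Local Open Scope classical_set_scope.

Lemma rect_set_interior (R : realType) (A : int_rectangle) (p : R * R) :
  (rect_set R A)° p <->
  (xlo A)%:~R < p.1 < (xhi A)%:~R /\ (ylo A)%:~R < p.2 < (yhi A)%:~R.
Proof.
split=> [[[P Q] /= [Pp Qp] PQ]|[hx hy]].
  have Px : `[(xlo A)%:~R : R, (xhi A)%:~R]° p.1.
    apply: filterS Pp => x Px; have := nbhs_singleton Qp => Qp2.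
    by have /= := PQ (x, p.2) (conj Px Qp2) => -[].
  have Qy : `[(ylo A)%:~R : R, (yhi A)%:~R]° p.2.
    apply: filterS Qp => y Qy; have := nbhs_singleton Pp => Pp1.
    by have /= := PQ (p.1, y) (conj Pp1 Qy) => -[].
  by move: Px Qy; rewrite !interior_itv_bnd /= !in_itv.
exists (`[(xlo A)%:~R : R, (xhi A)%:~R], `[(ylo A)%:~R : R, (yhi A)%:~R]) => //.
split => /=.
  rewrite -[nbhs _ _]/(`[(xlo A)%:~R : R, (xhi A)%:~R]° p.1).
  by rewrite interior_itv_bnd /= in_itv.
rewrite -[nbhs _ _]/(`[(ylo A)%:~R : R, (yhi A)%:~R]° p.2).
by rewrite interior_itv_bnd /= in_itv.
Qed.

Lemma rect_setE (R : realType) (A : int_rectangle) (p : R * R) :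
  rect_set R A p <->
  (xlo A)%:~R <= p.1 <= (xhi A)%:~R /\ (ylo A)%:~R <= p.2 <= (yhi A)%:~R.
Proof. by rewrite /rect_set /box /= !in_itv /=; split. Qed.

(** Midpoints of unit intervals turn real inequalities into integer ones. *)
Lemma half_itv (R : realType) (a b c : int) :
  (a%:~R <= (c%:~R + 2^-1 : R) <= b%:~R) = (a <= c < b).
Proof.
have h : 0 < 2^-1 :> R by lra.
have h1 : 2^-1 < 1 :> R by lra.
apply/idP/idP => [/andP[l u]|/andP[l u]].
  apply/andP; split.
    rewrite -ltzD1 -(ltr_int R) intrD; lra.
  by rewrite -(ltr_int R); lra.
move: l u; rewrite -(ler_int R) -lezD1 -(ler_int R) intrD => l u.
by apply/andP; split; lra.
Qed.

Lemma half_oitv (R : realType) (a b c : int) :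
  (a%:~R < (c%:~R + 2^-1 : R) < b%:~R) = (a <= c < b).
Proof.
have h : 0 < 2^-1 :> R by lra.
have h1 : 2^-1 < 1 :> R by lra.
apply/idP/idP => [/andP[/ltW l /ltW u]|/andP[l u]].
  by rewrite -(half_itv R) l u.
move: l u; rewrite -(ler_int R) -lezD1 -(ler_int R) intrD => l u.
by apply/andP; split; lra.
Qed.

(** Visibility along a vertical segment, in coordinates. *)
Definition line_visible (R : realType) (T : Type) (f : T -> int_rectangle)
    (u v : T) :=
  exists x y1 y2 : R, [/\ y1 < y2,
    (xlo (f u))%:~R < x < (xhi (f u))%:~R /\
      exists y, y1 <= y <= y2 /\ (ylo (f u))%:~R < y < (yhi (f u))%:~R,
    (xlo (f v))%:~R < x < (xhi (f v))%:~R /\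
      exists y, y1 <= y <= y2 /\ (ylo (f v))%:~R < y < (yhi (f v))%:~R &
    forall w, w <> u -> w <> v -> (xlo (f w))%:~R <= x <= (xhi (f w))%:~R ->
      forall y, y1 <= y <= y2 -> ~~ ((ylo (f w))%:~R <= y <= (yhi (f w))%:~R)].

(** A segment at abscissa x lies in the unit column given by the floor of x;
    conversely the middle line of a unit column meets exactly the rectangles that
    the column meets, and the segment is taken between the bottom cells of the two
    rectangles. *)
Lemma line_visibleP (R : realType) (T : eqType) (f : T -> int_rectangle) u v :
    disjoint_family f -> u != v ->
  line_visible R f u v <-> col_visible f u v.
Proof.
move=> dis uv; split.
  case=> x [y1 [y2 [y12 [ux [yu [yu12 uy]]] [vx [yv [yv12 vy]]] out]]].
  have col w : (xlo (f w))%:~R < x < (xhi (f w))%:~R -> in_col (f w) (Num.floor x).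
    by move=> /andP[/ltW lx xl]; rewrite /in_col floor_ge_int lx floor_lt_int xl.
  have lt t := ylo_lt_yhi (f t).
  exists (Num.floor x); split; rewrite ?col // => w /andP[wl wu].
  have wx : (xlo (f w))%:~R <= x <= (xhi (f w))%:~R.
    rewrite -floor_ge_int wl /=; apply: ltW; apply: lt_le_trans (floorD1_gt x) _.
    by rewrite ler_int lezD1.
  have [->|/eqP wu'] := eqVneq w u.
    by rewrite /y_between; have := lt u; have := lt v; clear; lia.
  have [->|/eqP wv'] := eqVneq w v.
    by rewrite /y_between; have := lt u; have := lt v; clear; lia.
  have ltw : (ylo (f w))%:~R < (yhi (f w))%:~R :> R by rewrite ltr_int.
  apply/negP => bet; have yw : y1 <= (ylo (f w))%:~R <= y2.
    by case/orP: bet; rewrite -!(ler_int R) => /andP[? ?]; lra.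
  by move: (out w wu' wv' wx _ yw); rewrite lexx ltW.
case=> c [uc vc out]; have yuv : ~~ y_overlap (f u) (f v).
  by have := dis u v uv; rewrite (col_overlap uc vc).
pose mid t : R := (ylo (f t))%:~R + 2^-1.
have midP t : (ylo (f t))%:~R < mid t < (yhi (f t))%:~R.
  by rewrite half_oitv lexx ylo_lt_yhi.
have sep t t' : in_col (f t) c -> in_col (f t') c -> t != t' ->
    (yhi (f t))%:~R <= (ylo (f t'))%:~R :> R \/ (yhi (f t'))%:~R <= (ylo (f t))%:~R :> R.
  move=> tc tc' tt'; have := dis t t' tt'; rewrite (col_overlap tc tc') !ler_int.
  by rewrite /y_overlap; lia.
exists (c%:~R + 2^-1), (Num.min (mid u) (mid v)), (Num.max (mid u) (mid v)).
have := midP u; have := midP v => mv mu.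
split.
- rewrite lt_max !gt_min !ltxx /= orbF; have [h|h] := sep u v uc vc uv.
    have -> : mid u < mid v by lra.
    by rewrite orbT.
  by have -> : mid v < mid u by lra.
- rewrite half_oitv; split=> //; exists (mid u).
  by rewrite le_max ge_min lexx.
- rewrite half_oitv; split=> //; exists (mid v).
  by rewrite le_max ge_min lexx !orbT.
move=> w /eqP wu /eqP wv; rewrite half_itv => wc y; apply: contraTN => wy.
have := out w wc; rewrite /y_between -!(ler_int R).
have := sep w u wc uc wu; have := sep w v wc vc wv; have := sep u v uc vc uv.
rewrite ge_min le_max => huv hwv hwu nb; apply/negP; move: nb wy.
by case: huv => huv; case: hwv => hwv; case: hwu => hwu; lra.
Qed.

Lemma transpose_disjoint (T : eqType) (f : T -> int_rectangle) :
  disjoint_family f -> disjoint_family (transpose \o f).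
Proof. by move=> dis u v uv; move: (dis u v uv); rewrite andbC. Qed.

Lemma disjoint_family_inj (T : eqType) (f : T -> int_rectangle) :
  disjoint_family f -> injective f.
Proof.
move=> dis u v fuv; apply/eqP/negPn/negP => uv; have := dis u v uv.
rewrite fuv /x_overlap /y_overlap; have := xlo_lt_xhi (f v).
by have := ylo_lt_yhi (f v); lia.
Qed.

(** Horizontal segments are handled by exchanging the axes. *)
Lemma sees_visible (R : realType) (T : eqType) (f : T -> int_rectangle) u v :
    disjoint_family f -> u != v ->
  sees R (range f) (f u) (f v) <-> row_visible f u v \/ col_visible f u v.
Proof.
move=> dis uv; have dist := transpose_disjoint dis.
have inj := disjoint_family_inj dis.
rewrite -(line_visibleP R dis uv).
rewrite -[row_visible f u v]/(col_visible (transpose \o f) u v).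
rewrite -(line_visibleP R dist uv); split.
  case=> l [[[x [y1 [y2 [y12 ->]]]]|[y [x1 [x2 [x12 ->]]]]] mu mv out]; [right|left].
    exists x, y1, y2; split=> //.
    - case: mu => -[px py] [[/= -> py12] /rect_set_interior[/= ux uy]].
      by split=> //; exists py.
    - case: mv => -[px py] [[/= -> py12] /rect_set_interior[/= ux uy]].
      by split=> //; exists py.
    move=> w wu wv xw y y12'; apply/negP => yw.
    have : ([set x] `*` `[y1, y2] `&` rect_set R (f w)) (x, y).
      by split; [split | apply/rect_setE].
    by rewrite out; [case | exists w | move/inj | move/inj].
  exists y, x1, x2; split=> //.
  - case: mu => -[px py] [[/= px12 ->] /rect_set_interior[/= ux uy]].
    by split=> //; exists px.
  - case: mv => -[px py] [[/= px12 ->] /rect_set_interior[/= ux uy]].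
    by split=> //; exists px.
  move=> w wu wv xw x x12'; apply/negP => yw.
  have : (`[x1, x2] `*` [set y] `&` rect_set R (f w)) (x, y).
    by split; [split | apply/rect_setE].
  by rewrite out; [case | exists w | move/inj | move/inj].
case=> -[x [y1 [y2 [y12 [ux [yu [yu12 uy]]] [vx [yv [yv12 vy]]] out]]]].
  exists (`[y1, y2] `*` [set x]); split; first by right; exists x, y1, y2.
  - by exists (yu, x); split; [split | apply/rect_set_interior].
  - by exists (yv, x); split; [split | apply/rect_set_interior].
  move=> _ [w _ <-] wu wv; apply/seteqP; split=> // -[px py].
  move=> [[/= px12 ->] /rect_setE[/= xw yw]].
  have wu' : w <> u by move=> e; apply: wu; rewrite e.
  have wv' : w <> v by move=> e; apply: wv; rewrite e.
  by have /negP := out w wu' wv' yw px px12; apply.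
exists ([set x] `*` `[y1, y2]); split; first by left; exists x, y1, y2.
- by exists (x, yu); split; [split | apply/rect_set_interior].
- by exists (x, yv); split; [split | apply/rect_set_interior].
move=> _ [w _ <-] wu wv; apply/seteqP; split=> // -[px py].
move=> [[/= -> py12] /rect_setE[/= xw yw]].
have wu' : w <> u by move=> e; apply: wu; rewrite e.
have wv' : w <> v by move=> e; apply: wv; rewrite e.
by have /negP := out w wu' wv' xw py py12; apply.
Qed.

Lemma disjoint_familyP (R : realType) (T : eqType) (f : T -> int_rectangle) :
    injective f ->
  trivIset (range f) (fun A => (rect_set R A)°) <-> disjoint_family f.
Proof.
move=> inj; split=> [triv u v uv|dis].
  apply/negP => /andP[xuv yuv]; move/eqP: uv; apply; apply: inj.
  apply: triv; [by exists u | by exists v|].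
  exists ((Num.max (xlo (f u)) (xlo (f v)))%:~R + 2^-1,
          (Num.max (ylo (f u)) (ylo (f v)))%:~R + 2^-1).
  have := xlo_lt_xhi (f u); have := xlo_lt_xhi (f v).
  have := ylo_lt_yhi (f u); have := ylo_lt_yhi (f v).
  move: xuv yuv; rewrite /x_overlap /y_overlap => *.
  by split; apply/rect_set_interior; rewrite !half_oitv; split; lia.
move=> _ _ [u _ <-] [v _ <-] [p [/rect_set_interior[xu yu] /rect_set_interior[xv yv]]].
congr f; apply/eqP/negPn/negP => uv; have := dis u v uv.
by rewrite /x_overlap /y_overlap -!(ltr_int R); lra.
Qed.

Lemma rv_repP (R : realType) (T : finType) (G : sgraph T) (S : set int_rectangle) :
  rv_rep R G S <-> exists f : T -> int_rectangle,
    [/\ S = range f, disjoint_family f & forall u v, u != v ->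
      (adj G u v <-> row_visible f u v \/ col_visible f u v)].
Proof.
split=> [[_ triv [f [[fS inj surj] adjG]]]|[f [-> dis adjG]]].
  have inj' : injective f by move=> u v; apply: inj; rewrite inE.
  have SE : S = range f.
    by apply/seteqP; split=> [A /surj //|_ [u _ <-]]; exact: fS.
  have dis : disjoint_family f by apply/(disjoint_familyP R inj'); rewrite -SE.
  exists f; split=> // u v uv.
  by rewrite adjG // SE; exact: sees_visible.
have inj := disjoint_family_inj dis; split.
- exact: finite_image.
- exact/disjoint_familyP.
- exists f; split; last first.
    by move=> u v uv; rewrite (sees_visible R dis uv); exact: adjG.
  split; [by move=> u _; exists u | by move=> u v _ _ /inj | by []].
Qed.

(** * Bounding boxes, isolated vertices and minima *)

Lemma rect_set_sub_box (R : realType) (A : int_rectangle) (x1 x2 y1 y2 : R) :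
  rect_set R A `<=` box x1 x2 y1 y2 <->
  [/\ x1 <= (xlo A)%:~R, (xhi A)%:~R <= x2, y1 <= (ylo A)%:~R & (yhi A)%:~R <= y2].
Proof.
have ltx : (xlo A)%:~R < (xhi A)%:~R :> R by rewrite ltr_int xlo_lt_xhi.
have lty : (ylo A)%:~R < (yhi A)%:~R :> R by rewrite ltr_int ylo_lt_yhi.
split=> [sub|[x1A x2A y1A y2A] p /rect_setE[px py]].
  have /sub : rect_set R A ((xlo A)%:~R, (ylo A)%:~R) by apply/rect_setE => /=; split; lra.
  have /sub : rect_set R A ((xhi A)%:~R, (yhi A)%:~R) by apply/rect_setE => /=; split; lra.
  by rewrite /box /= !in_itv /= => -[? ?] [? ?]; split; lra.
by rewrite /box /= !in_itv /=; split; lra.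
Qed.

(** The lengths of the sides are recorded as they are needed to bound them for an
    explicit representation. *)
Lemma bounding_box_exists (R : realType) n (f : 'I_n.+1 -> int_rectangle) :
  exists b, [/\ bounding_box R (range f) b,
    exists i j, side_x b = `|xhi (f j) - xlo (f i)|%N &
    exists i j, side_y b = `|yhi (f j) - ylo (f i)|%N].
Proof.
case: (@arg_minP _ _ _ (@ord0 n) predT (xlo \o f) isT) => a _ /= amin.
case: (@arg_maxP _ _ _ (@ord0 n) predT (xhi \o f) isT) => b _ /= bmax.
case: (@arg_minP _ _ _ (@ord0 n) predT (ylo \o f) isT) => c _ /= cmin.
case: (@arg_maxP _ _ _ (@ord0 n) predT (yhi \o f) isT) => d _ /= dmax.
have ltx : xlo (f a) < xhi (f b) := lt_le_trans (xlo_lt_xhi (f a)) (bmax a isT).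
have lty : ylo (f c) < yhi (f d) := lt_le_trans (ylo_lt_yhi (f c)) (dmax c isT).
exists (IntRectangle ltx lty); split; [|by exists a, b|by exists c, d].
split=> [_ [t _ <-]|x1 x2 y1 y2 sub].
  apply/rect_set_sub_box; rewrite !ler_int /=.
  by split; [exact: amin | exact: bmax | exact: cmin | exact: dmax].
have sub' t : rect_set R (f t) `<=` box x1 x2 y1 y2 by apply: sub; exists t.
apply/rect_set_sub_box; split.
- by have /rect_set_sub_box[] := sub' a.
- by have /rect_set_sub_box[] := sub' b.
- by have /rect_set_sub_box[] := sub' c.
- by have /rect_set_sub_box[] := sub' d.
Qed.

Lemma uniq_int_size (s : seq int) (a b : int) :
  uniq s -> all (fun r => a <= r < b) s -> (size s <= `|b - a|)%N.
Proof.
move=> us /allP sab; rewrite -(size_map (fun r => `|r - a|%N)) -(size_iota 0 `|b - a|).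
apply: uniq_leq_size.
  rewrite map_inj_in_uniq // => r r' /sab ? /sab ?; lia.
by move=> _ /mapP[r /sab rab ->]; rewrite mem_iota; lia.
Qed.

Lemma meets_rows_side_y (R : realType) (T : finType) (f : T -> int_rectangle) b n :
  bounding_box R (range f) b -> meets_rows f n -> (n <= side_y b)%N.
Proof.
move=> [inb _] [s [<- us rs]]; apply: uniq_int_size us _.
apply: sub_all rs => r /existsP[t]; rewrite /in_row.
have /rect_set_sub_box[_ _] : rect_set R (f t) `<=` rect_set R b by apply: inb; exists t.
rewrite !ler_int; lia.
Qed.

Lemma meets_cols_side_x (R : realType) (T : finType) (f : T -> int_rectangle) b n :
  bounding_box R (range f) b -> meets_cols f n -> (n <= side_x b)%N.
Proof.
move=> [inb _] [s [<- us rs]]; apply: uniq_int_size us _.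
apply: sub_all rs => r /existsP[t]; rewrite /in_row /=.
have /rect_set_sub_box[+ +] : rect_set R (f t) `<=` rect_set R b by apply: inb; exists t.
rewrite !ler_int; lia.
Qed.

(** If u shared a row with another rectangle, it would see the nearest one in that
    row. *)
Lemma isolated_y_overlap (T : finType) (f : T -> int_rectangle) u :
    (forall v, v != u -> ~ row_visible f u v) ->
  forall v, v != u -> ~~ y_overlap (f u) (f v).
Proof.
move=> iso v vu; apply/negP => ov.
pose r := Order.max (ylo (f u)) (ylo (f v)).
have ur : in_row (f u) r.
  by move: ov; rewrite /in_row /r /y_overlap; have := ylo_lt_yhi (f u); lia.
have vr : (v != u) && in_row (f v) r.
  by rewrite vu; move: ov; rewrite /in_row /r /y_overlap; have := ylo_lt_yhi (f v); lia.
case: (@arg_minP _ _ _ v (fun w => (w != u) && in_row (f w) r)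
  (fun w => `|xlo (f w) - xlo (f u)|) vr) => w /andP[wu wr] near.
apply: (iso w wu); exists r; split=> // w' w'r; apply/negP => bet.
have w'u : w' != u.
  apply: contraTneq bet => ->; rewrite /x_between; have := xlo_lt_xhi (f u).
  have := xlo_lt_xhi (f w); lia.
have := near w'; rewrite w'u w'r => /(_ isT).
move: bet; rewrite /x_between; have := xlo_lt_xhi (f u).
have := xlo_lt_xhi (f w); have := xlo_lt_xhi (f w'); lia.
Qed.

(** Each isolated rectangle contributes its bottom row. *)
Lemma meets_rows_isolated m n (mn : (m <= n)%N) (f : 'I_n -> int_rectangle) k :
    (forall t v : 'I_n, (m <= t)%N -> v != t -> ~~ y_overlap (f t) (f v)) ->
  meets_rows (f \o widen_ord mn) k -> meets_rows f (k + (n - m)).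
Proof.
move=> iso [s [ss us rs]].
pose I := drop m (enum 'I_n).
have sI : size I = (n - m)%N by rewrite size_drop size_enum_ord.
have mI t : t \in I -> (m <= t)%N.
  move=> /(map_f val); rewrite /I map_drop val_enum_ord drop_iota mem_iota.
  by case/andP.
exists (s ++ [seq ylo (f t) | t <- I]); split.
- by rewrite size_cat size_map ss sI.
- rewrite cat_uniq us /=; apply/andP; split.
    apply/hasPn => _ /mapP[t /mI mt ->].
    apply/negP => /(allP rs) /existsP[v] /= vr.
    have vt : widen_ord mn v != t.
      by apply: contraTneq mt => <-; rewrite -ltnNge; exact: ltn_ord v.
    move/negP: (iso t (widen_ord mn v) mt vt); apply.
    by apply: row_overlap _ vr; rewrite /in_row lexx ylo_lt_yhi.
  rewrite map_inj_in_uniq ?drop_uniq ?enum_uniq //.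
  move=> t t' /mI mt _ E; apply/eqP/negPn/negP => tt'.
  move: (iso t t' mt); rewrite eq_sym tt' => /(_ isT).
  have := ylo_lt_yhi (f t); have := ylo_lt_yhi (f t'); rewrite /y_overlap E; lia.
- rewrite all_cat; apply/andP; split; apply/allP => r.
    move=> /(allP rs) /existsP[v vr]; apply/existsP.
    by exists (widen_ord mn v).
  case/mapP=> t _ ->; apply/existsP; exists t.
  by rewrite /in_row lexx ylo_lt_yhi.
Qed.

Lemma minimumP (A : set nat) : A !=set0 -> A (minimum A) /\ lbound A (minimum A).
Proof.
move=> [k Ak]; rewrite /minimum; apply: (xgetPex 0%N (P := [set m | A m /\ lbound A m])).
have ex : exists n, `[< A n >] by exists k; exact/asboolP.
case: (ex_minnP ex) => m /asboolP Am min; exists m; split=> // j Aj.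
by rewrite leEnat; apply: min; exact/asboolP.
Qed.

Lemma graph_min_le (R : realType) (mu : int_rectangle -> nat) (T : finType)
    (G : sgraph T) S b :
  rv_rep R G S -> bounding_box R S b -> (graph_min R mu G <= mu b)%N.
Proof.
move=> rep bb; rewrite /graph_min; set A := [set k | _].
have Ab : A (mu b) by exists S, b.
by have [_ lb] := @minimumP A (ex_intro _ _ Ab); exact: (lb _ Ab).
Qed.

(** The existence of a representation excludes the default value of the minimum. *)
Lemma graph_min_gt (R : realType) (mu : int_rectangle -> nat) (T : finType)
    (G : sgraph T) k :
    (exists S b, rv_rep R G S /\ bounding_box R S b) ->
    (forall S b, rv_rep R G S -> bounding_box R S b -> (k < mu b)%N) ->
  (k < graph_min R mu G)%N.
Proof.
move=> [S [b [rep bb]]] lb; rewrite /graph_min; set A := [set k | _].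
have Ab : A (mu b) by exists S, b.
have [[S' [b' [rep' bb' E]]] _] := @minimumP A (ex_intro _ _ Ab).
by rewrite E; exact: lb rep' bb'.
Qed.

Lemma sub_clique (m n : nat) (mn : (m <= n)%N) (f : 'I_n -> int_rectangle) :
    disjoint_family f ->
    (forall u v : 'I_n, u != v -> (u < m)%N -> (v < m)%N ->
      row_visible f u v \/ col_visible f u v) ->
  clique_rep (f \o widen_ord mn).
Proof.
move=> dis vis; split=> u v uv; have uv' : widen_ord mn u != widen_ord mn v.
- by apply: contraNneq uv => /(congr1 val)/= /val_inj ->.
- exact: dis.
- by apply: contraNneq uv => /(congr1 val)/= /val_inj ->.
by case: (vis _ _ uv' (ltn_ord u) (ltn_ord v)) => -[r [? ? out]]; [left|right];
  exists r; split=> // w; exact: out.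
Qed.

Definition clique_and_isolated (m n : nat) (G : sgraph 'I_n) :=
  forall u v, adj G u v = [&& u != v, (u < m)%N & (v < m)%N].

(** Removing rectangles unblocks views, so the first m rectangles still represent a
    complete graph, and the isolated ones add n - m rows and columns. *)
Lemma clique_and_isolated_sides (R : realType) m n (mn : (m <= n)%N)
    (G : sgraph 'I_n) S b :
    clique_and_isolated m G -> rv_rep R G S -> bounding_box R S b ->
  exists f : 'I_m -> int_rectangle, clique_rep f /\
    forall h w, meets_rows f h -> meets_cols f w ->
      (h + (n - m) <= side_y b)%N /\ (w + (n - m) <= side_x b)%N.
Proof.
move=> adjG /rv_repP[f [-> dis vis]] bb; exists (f \o widen_ord mn).
split.
  by apply: sub_clique => // u v uv um vm; apply/vis => //; rewrite adjG uv um vm.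
have iso (t v : 'I_n) : (m <= t)%N -> v != t -> ~ (row_visible f t v \/ col_visible f t v).
  move=> mt vt; have := vis t v; rewrite eq_sym => /(_ vt) <-.
  by rewrite adjG [(t < m)%N]ltnNge mt /= andbF.
move=> h w rows cols; split.
  apply: (meets_rows_side_y bb); apply: meets_rows_isolated rows => t v mt vt.
  by apply: isolated_y_overlap vt => v' v't vis'; apply: (iso t v' mt v't); left.
apply: (meets_cols_side_x bb); rewrite /meets_cols.
apply: (@meets_rows_isolated _ _ mn) cols => t v mt vt.
by apply: isolated_y_overlap vt => v' v't vis'; apply: (iso t v' mt v't); right.
Qed.

(** * Explicit representations and the comparison *)

Definition clique_and_isolated_graph (m n : nat) : sgraph 'I_n.
Proof.
refine (@SGraph 'I_n (fun u v => [&& u != v, (u < m)%N & (v < m)%N]) _ _).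
- by move=> u v /=; rewrite eq_sym [(u < m)%N && _]andbC.
- by move=> u /=; rewrite eqxx.
Defined.

Lemma clique_and_isolated_graphP m n :
  clique_and_isolated m (clique_and_isolated_graph m n).
Proof. by []. Qed.

Definition diagonal_square (k : nat) : int_rectangle :=
  @IntRectangle k%:Z k.+1%:Z k%:Z k.+1%:Z (ltnSn k) (ltnSn k).

(** A representation of the complete graph on 8 vertices in a 10 by 10 box.  Its
    first 7 rectangles represent the complete graph on 7 vertices, and taking none
    of them leaves the empty graph. *)
Definition eight_rectangles : seq int_rectangle :=
  [:: @IntRectangle 0 10 0 1 isT isT; @IntRectangle 9 10 1 10 isT isT;
      @IntRectangle 2 5 1 3 isT isT; @IntRectangle 6 8 2 5 isT isT;
      @IntRectangle 4 7 6 8 isT isT; @IntRectangle 0 1 2 10 isT isT;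
      @IntRectangle 1 3 4 7 isT isT; @IntRectangle 1 9 9 10 isT isT].

Definition core (i : nat) := nth (diagonal_square 0) eight_rectangles i.

(** The shift by 10 puts the isolated squares above and to the right of the core. *)
Definition sample_rep (m n : nat) (i : 'I_n) : int_rectangle :=
  if (i < m)%N then core i else diagonal_square (10 + i).

Lemma core_bounds i : (i < 8)%N -> (xhi (core i) <= 10) && (yhi (core i) <= 10).
Proof.
move=> i8.
have : all (fun i => (xhi (core i) <= 10) && (yhi (core i) <= 10)) (iota 0 8).
  by vm_compute.
by move=> /allP; apply; rewrite mem_iota.
Qed.

Lemma core_disjoint i j : (i < 8)%N -> (j < 8)%N -> i != j ->
  ~~ (x_overlap (core i) (core j) && y_overlap (core i) (core j)).
Proof.
move=> i8 j8; have : all (fun i => all (fun j => (i != j) ==>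
    ~~ (x_overlap (core i) (core j) && y_overlap (core i) (core j)))
    (iota 0 8)) (iota 0 8).
  by vm_compute.
move=> /allP/(_ i); rewrite mem_iota => /(_ i8)/allP/(_ j); rewrite mem_iota.
by move=> /(_ j8)/implyP.
Qed.

Lemma core_visible i j : (i < 8)%N -> (j < 8)%N -> i != j ->
  exists c : nat, (c < 10)%N /\
    ([&& in_row (core i) c, in_row (core j) c & all (fun k =>
        in_row (core k) c ==> ~~ x_between (core i) (core k) (core j)) (iota 0 8)] \/
     [&& in_col (core i) c, in_col (core j) c & all (fun k =>
        in_col (core k) c ==> ~~ y_between (core i) (core k) (core j)) (iota 0 8)]).
Proof.
move=> i8 j8; have : all (fun i => all (fun j => (i != j) ==> has (fun c : nat =>
    [&& in_row (core i) c, in_row (core j) c & all (fun k =>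
        in_row (core k) c ==> ~~ x_between (core i) (core k) (core j)) (iota 0 8)] ||
     [&& in_col (core i) c, in_col (core j) c & all (fun k =>
        in_col (core k) c ==> ~~ y_between (core i) (core k) (core j)) (iota 0 8)])
    (iota 0 10)) (iota 0 8)) (iota 0 8).
  by vm_compute.
move=> /allP/(_ i); rewrite mem_iota => /(_ i8)/allP/(_ j); rewrite mem_iota.
move=> /(_ j8)/implyP vis ij; have /hasP[c] := vis ij; rewrite mem_iota => c10.
by move=> /orP h; exists c.
Qed.

Lemma sample_rep_disjoint m n : (m <= 8)%N -> disjoint_family (@sample_rep m n).
Proof.
move=> m8 u v uv; rewrite /sample_rep; have {}uv : (u != v :> nat) by [].
case: (ltnP u m) => um; case: (ltnP v m) => vm.
- by apply: core_disjoint uv; apply: leq_trans m8.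
- have := core_bounds (leq_trans um m8); rewrite /x_overlap /=; lia.
- have := core_bounds (leq_trans vm m8); rewrite /x_overlap /=; lia.
- rewrite /x_overlap /=; lia.
Qed.

Lemma sample_rep_visible m n (u v : 'I_n) : (m <= 8)%N -> u != v ->
  [&& u != v, (u < m)%N & (v < m)%N] <->
  row_visible (@sample_rep m n) u v \/ col_visible (@sample_rep m n) u v.
Proof.
move=> m8 uv; rewrite uv /=; split=> [/andP[um vm]|vis]; last first.
  have ov : x_overlap (sample_rep m u) (sample_rep m v) ||
      y_overlap (sample_rep m u) (sample_rep m v).
    apply/orP; case: vis => vis; first by right; exact: row_visible_overlap vis.
    by left; exact: col_visible_overlap vis.
  have {}uv : (u != v :> nat) by [].
  move: ov; rewrite /sample_rep.
  case: (ltnP u m) => um; case: (ltnP v m) => vm //=.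
  - have := core_bounds (leq_trans um m8); rewrite /x_overlap /y_overlap /=; lia.
  - have := core_bounds (leq_trans vm m8); rewrite /x_overlap /y_overlap /=; lia.
  - rewrite /x_overlap /y_overlap /=; lia.
have [c [c10 vis]] := core_visible (leq_trans um m8) (leq_trans vm m8) uv.
case: vis => /and3P[uc vc /allP out]; [left|right]; exists c%:Z.
  split; rewrite /sample_rep ?um ?vm // => w; case: (ltnP w m) => wm.
    by apply/implyP/out; rewrite mem_iota; apply: leq_trans m8.
  by rewrite /in_row /=; lia.
split; rewrite /sample_rep ?um ?vm // => w; case: (ltnP w m) => wm.
  by apply/implyP/out; rewrite mem_iota; apply: leq_trans m8.
by rewrite /in_col /=; lia.
Qed.

Lemma sample_rv_rep (R : realType) m n (G : sgraph 'I_n) : (m <= 8)%N ->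
  clique_and_isolated m G -> rv_rep R G (range (@sample_rep m n)).
Proof.
move=> m8 adjG; apply/rv_repP; exists (@sample_rep m n); split=> //.
  exact: sample_rep_disjoint.
by move=> u v uv; rewrite adjG; exact: sample_rep_visible.
Qed.

Lemma clique_and_isolated_rvg (R : realType) m n (G : sgraph 'I_n) :
    (m <= 8)%N -> (0 < n)%N -> clique_and_isolated m G ->
  exists S b, rv_rep R G S /\ bounding_box R S b.
Proof.
case: n G => // n G m8 _ adjG; exists (range (@sample_rep m n.+1)).
have [b [bb _ _]] := bounding_box_exists R (@sample_rep m n.+1).
by exists b; split=> //; exact: sample_rv_rep.
Qed.

Lemma empty_graph_sides (R : realType) n : (0 < n)%N ->
  exists S b, [/\ rv_rep R (empty_graph n) S, bounding_box R S b,
    (side_x b <= n)%N & (side_y b <= n)%N].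
Proof.
case: n => // n _; exists (range (@sample_rep 0 n.+1)).
have [b [bb [i [j xb]] [k [l yb]]]] := bounding_box_exists R (@sample_rep 0 n.+1).
exists b; split=> //.
- by apply: sample_rv_rep => // u v; rewrite /= andbF.
- by rewrite xb /sample_rep /=; have := ltn_ord i; have := ltn_ord j; lia.
- by rewrite yb /sample_rep /=; have := ltn_ord k; have := ltn_ord l; lia.
Qed.

Lemma clique_and_isolated_exceeds_empty (R : realType)
    (mu : int_rectangle -> nat) (m n bound : nat) :
    (m <= 8)%N -> (0 < n)%N ->
    (forall b, (side_x b <= n)%N -> (side_y b <= n)%N -> (mu b <= bound)%N) ->
    (forall S b, rv_rep R (clique_and_isolated_graph m n) S ->
      bounding_box R S b -> (bound < mu b)%N) ->
  is_rvg R (clique_and_isolated_graph m n) /\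
  (graph_min R mu (clique_and_isolated_graph m n) >
   graph_min R mu (empty_graph n))%N.
Proof.
move=> m8 n0 mu_empty mu_clique.
have [S [b [rep bb]]] := clique_and_isolated_rvg R m8 n0
  (@clique_and_isolated_graphP m n).
split; first by exists S.
have [S0 [b0 [rep0 bb0 x0 y0]]] := empty_graph_sides R n0.
apply: leq_ltn_trans (graph_min_le mu rep0 bb0) _.
apply: leq_ltn_trans (mu_empty _ x0 y0) _.
by apply: graph_min_gt mu_clique; exists S, b.
Qed.

Lemma seven_clique_and_isolated_sides (R : realType) n S b : (7 <= n)%N ->
    rv_rep R (clique_and_isolated_graph 7 n) S -> bounding_box R S b ->
  (n <= side_y b /\ n < side_x b \/ n < side_y b /\ n <= side_x b)%N.
Proof.
move=> n7 rep bb; have [f [cf sides]] :=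
  clique_and_isolated_sides n7 (@clique_and_isolated_graphP _ _) rep bb.
case: (seven_clique_rows_cols cf (card_ord 7)) => -[rows cols];
  have := sides _ _ rows cols; lia.
Qed.

Lemma eight_clique_and_isolated_sides (R : realType) n S b : (8 <= n)%N ->
    rv_rep R (clique_and_isolated_graph 8 n) S -> bounding_box R S b ->
  (n < side_y b /\ n < side_x b)%N.
Proof.
move=> n8 rep bb; have [f [cf sides]] :=
  clique_and_isolated_sides n8 (@clique_and_isolated_graphP _ _) rep bb.
have := sides _ _ (eight_clique_rows cf (card_ord 8)) (eight_clique_cols cf (card_ord 8)).
lia.
Qed.

Theorem corollary6p13 (R : realType) :
  (forall n : nat, (7 <= n)%N ->
     [/\ exists G : sgraph 'I_n,
           is_rvg R G /\ (width R G > width R (empty_graph n))%N,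
         exists G : sgraph 'I_n,
           is_rvg R G /\ (area R G > area R (empty_graph n))%N
       & exists G : sgraph 'I_n,
           is_rvg R G /\ (perim R G > perim R (empty_graph n))%N]) /\
  (forall n : nat, (8 <= n)%N ->
     exists G : sgraph 'I_n,
       is_rvg R G /\ (height R G > height R (empty_graph n))%N).
Proof.
split=> n n_ge.
  have n0 : (0 < n)%N by exact: leq_trans n_ge.
  split; exists (clique_and_isolated_graph 7 n).
  - apply: (@clique_and_isolated_exceeds_empty _ rect_width 7 n n) => // [b|S b rep bb].
      by rewrite /rect_width; lia.
    by have := seven_clique_and_isolated_sides n_ge rep bb; rewrite /rect_width; lia.
  - apply: (@clique_and_isolated_exceeds_empty _ rect_area 7 n (n * n))
      => // [b xb yb|S b rep bb].
      by rewrite /rect_area leq_mul.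
    by have := seven_clique_and_isolated_sides n_ge rep bb; rewrite /rect_area; nia.
  - apply: (@clique_and_isolated_exceeds_empty _ rect_perim 7 n (2 * (n + n)))
      => // [b|S b rep bb].
      by rewrite /rect_perim; lia.
    by have := seven_clique_and_isolated_sides n_ge rep bb; rewrite /rect_perim; lia.
exists (clique_and_isolated_graph 8 n).
apply: (@clique_and_isolated_exceeds_empty _ rect_height 8 n n) => // [|b|S b rep bb].
- exact: leq_trans n_ge.
- by rewrite /rect_height; lia.
- by have := eight_clique_and_isolated_sides n_ge rep bb; rewrite /rect_height; lia.
Qed.
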